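(* Let $m>0$ be an even integer. Consider the following procedure. Work in the finite-dimensional vector space $(\mathcal A/\mathcal A\operatorname{Sq}^1)^m$ with basis represented by the admissible words of degree $m$ not ending in $\operatorname{Sq}^1$. Form all columns $$\overline{\alpha\operatorname{Sq}^{2^j}},\qquad j>0,\quad 2^j<m,\quad |\alpha|=m-2^j,$$ where $\alpha$ runs through the admissible basis of $\mathcal A^{m-2^j}$; reduce each product by tracked Adem reduction, discard the terms ending in $\operatorname{Sq}^1$, and solve over $\mathbb F_2$ the finite linear system $$\overline{\operatorname{Sq}^m}+\sum_{\alpha,j}c_{\alpha,j}\,\overline{\alpha\operatorname{Sq}^{2^j}}=0\quad\text{in }(\mathcal A/\mathcal A\operatorname{Sq}^1)^m\qquad(\ast)$$ in the unknowns $c_{\alpha,j}\in\mathbb F_2$. Then: (1) this finite procedure terminates; (2) if $m$ is a power of $2$, the system $(\ast)$ has no solution; (3) if $m$ is not a power of $2$, the system $(\ast)$ has a solution; (4) for any solution $(c_{\alpha,j})$, put $y_m=\operatorname{Sq}^m+\sum_{\alpha,j}c_{\alpha,j}\alpha\operatorname{Sq}^{2^j}$. Then $\operatorname{Adm}(y_m)\in\mathcal A\operatorname{Sq}^1$, and for any choice of $b_m^{\mathrm{can}}\in\mathcal A^{m-1}$ with $\operatorname{Adm}(y_m)=b_m^{\mathrm{can}}\operatorname{Sq}^1$ (no uniqueness of $b_m^{\mathrm{can}}$ is asserted) the elements $$r_m=e_m+\sum_{\alpha,j}c_{\alpha,j}\,\alpha e_{2^j},\qquad \widetilde r_m=r_m+b_m^{\mathrm{can}}e_1,\qquad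 H_m=\widehat T(y_m)$$ satisfy $\partial H_m=d_1(\widetilde r_m)$. Thus every even $m$ that is not a power of $2$ has an explicitly constructed triangular secondary syzygy track $H_m$, while every even power of $2$ gives no triangular lower-column relation of this form.
   Context: $\mathcal A$ is the mod-$2$ Steenrod algebra; $\overline x$ is the image of $x\in\mathcal A$ in $\mathcal A/\mathcal A\operatorname{Sq}^1$. A word $\operatorname{Sq}^{a_1}\cdots\operatorname{Sq}^{a_r}$ is admissible if $a_i\ge2a_{i+1}$ for all $i$; admissible words form a basis of $\mathcal A$. For $0<a<2b$ write $[a,b]=\operatorname{Sq}^a\operatorname{Sq}^b+\sum_{k=0}^{\lfloor a/2\rfloor}\binom{b-k-1}{a-2k}\operatorname{Sq}^{a+b-k}\operatorname{Sq}^k$ (binomials mod $2$, $\operatorname{Sq}^0=1$), so $[a,b]=0$ in $\mathcal A$. Pair algebra: $D_1\xrightarrow{\partial}D_0\to\mathcal A$ is Nassau's model at $2$ of Baues's secondary Steenrod algebra $\mathcal B$. $D_0$ (with $\mathbb Z/4$ coefficients) is generated by lifts $\widetilde{\operatorname{Sq}}^a$ of the squares and elements $Y_{k,l}$; $D_1$ is generated by a copy of $\mathcal A$ and elements $\mu_0a$, $U_{k,l}a$, with $\partial(\mu_0a)=2a$ and $\partial(U_{k,l}a)=Y_{k,l}a$. The secondary Adem track $u[a,b]$ (a Baues relation track transported to $D_1$) satisfies $\partial u[a,b]=[a,b]$ and, for words $\alpha,\beta$, $\partial(\alpha u[a,b]\beta)=\alpha[a,b]\beta$. A formal sum of words has the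 word lift to $D_0$, replacing each $\operatorname{Sq}^{a_1}\cdots\operatorname{Sq}^{a_r}$ by $\widetilde{\operatorname{Sq}}^{a_1}\cdots\widetilde{\operatorname{Sq}}^{a_r}$; an element in admissible normal form has the admissible lift, the same replacement on its admissible monomials. Tracked Adem reduction: for admissible $w$ set $\operatorname{Adm}(w)=w$, $T(w)=0$. Otherwise let $\operatorname{Sq}^a\operatorname{Sq}^b$ ($0<a<2b$) be the leftmost inadmissible adjacent pair, $w=\alpha\operatorname{Sq}^a\operatorname{Sq}^b\beta$, $w_k=\alpha\operatorname{Sq}^{a+b-k}\operatorname{Sq}^k\beta$, and set $\operatorname{Adm}(w)=\sum_k\operatorname{Adm}(w_k)$, $T(w)=\alpha u[a,b]\beta+\sum_kT(w_k)$, over $0\le k\le\lfloor a/2\rfloor$ with $\binom{b-k-1}{a-2k}$ odd. Extend additively to finite sums. The corrected track is $\widehat T(x)=T(x)+\sum_{a\in C(x)}\mu_0(a)$, with $C(x)$ the finite multiset of lifted $D_0$-monomials $a$ for which the mod-$2$ calculation cancels a duplicate $a+a$. Row: $d_1:\Sigma\mathcal Be_1\oplus\bigoplus_{i>0}\Sigma^{2i}\mathcal Be_{2i}\to\mathcal Bc_0$ is given by $d_1(e_1)=\widetilde{\operatorname{Sq}}^1c_0$, $d_1(e_{2i})=\widetilde{\operatorname{Sq}}^{2i}c_0$. The equality $\partial H_m=d_1(\widetilde r_m)$ is read in $D_0$ using the word lift for $y_m$ (each word $\operatorname{Sq}^{a_1}\cdots\operatorname{Sq}^{a_r}$ of the formal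 sum $y_m$ is replaced by $\widetilde{\operatorname{Sq}}^{a_1}\cdots\widetilde{\operatorname{Sq}}^{a_r}$) and the admissible lift for $b_m^{\mathrm{can}}\operatorname{Sq}^1$ (the same replacement on the admissible monomials of its admissible normal form), i.e. both sides are the sum of these two lifts. *)

(* Defs.v *)
From HB Require Import structures.
From mathcomp Require Import all_boot all_order all_algebra.
From mathcomp Require Import generic_quotient ring_quotient finmap boolp.
From mathcomp Require classical_sets.
From mathcomp.multinomials Require Import monalg.

Set Implicit Arguments.
Unset Strict Implicit.
Unset Printing Implicit Defensive.

Import GRing.Theory.
Local Open Scope ring_scope.

(** * Words and formal sums of words *)

(* [:: a1; ...; ar] stands for the word Sq^a1 ... Sq^ar. *)
Definition word := seq nat.

(* A formal sum of words is kept as the list of its terms, with repetitions. *)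
Definition fsum := seq word.

Definition wdeg (w : word) : nat := sumn w.

Definition admissible (w : word) : bool :=
  (0%N \notin w) && sorted [rel a b | (b.*2 <= a)%N] w.

(* The k that contribute to [a, b]. *)
Definition adem_idx (a b : nat) : seq nat :=
  [seq k <- iota 0 (a./2).+1 | odd 'C(b - k - 1, a - k.*2)].

(* Sq^(a+b-k) Sq^k, where Sq^0 = 1 is dropped. *)
Definition adem_pair (a b k : nat) : word :=
  if k == 0%N then [:: (a + b)%N] else [:: (a + b - k)%N; k].

(** * The mod 2 Steenrod algebra: generators Sq^n and Adem relations *)

Definition freeA := {malg 'F_2[{fmonom nat}]}.

Definition free_word (w : word) : freeA := << FMonom w >>.

Inductive adem_ideal : freeA -> Prop :=
| ai_sq0 : adem_ideal (free_word [:: 0%N] - 1)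
| ai_adem a b : (0 < a < b.*2)%N ->
    adem_ideal (free_word [:: a; b]
                + \sum_(k <- adem_idx a b) free_word [:: (a + b - k)%N; k])
| ai_sub x y : adem_ideal x -> adem_ideal y -> adem_ideal (x - y)
| ai_mul x y z : adem_ideal y -> adem_ideal (x * y * z).

Definition adem_pred : {pred freeA} := fun x => `[< adem_ideal x >].

Fact adem_zmod_closed : zmod_closed adem_pred.
Proof.
split=> [|x y /asboolP xI /asboolP yI]; last exact/asboolP/ai_sub.
apply/asboolP; rewrite -(subrr (free_word [:: 0%N] - 1)); by apply: ai_sub; exact: ai_sq0.
Qed.
HB.instance Definition _ := GRing.isZmodClosed.Build freeA adem_pred adem_zmod_closed.

Definition steenrod := {ideal_quot adem_pred}.
HB.instance Definition _ := GRing.Zmodule.on steenrod.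

Definition toA (x : freeA) : steenrod := (\pi x)%qT.
Definition ofA (a : steenrod) : freeA := generic_quotient.repr a.

Lemma ofAK a : toA (ofA a) = a. Proof. exact: reprK. Qed.

Lemma toAP x y : toA x = toA y <-> adem_ideal (x - y).
Proof.
have e : (toA x == toA y) = (x - y \in adem_pred) by rewrite Quotient.idealrBE.
split=> [/eqP|xy]; first by rewrite e => /asboolP.
by apply/eqP; rewrite e; apply/asboolP.
Qed.

Fact toA_zmod : zmod_morphism toA.
Proof. by move=> x y; rewrite /toA Quotient.pi_add Quotient.pi_opp. Qed.
HB.instance Definition _ := GRing.isZmodMorphism.Build freeA steenrod toA toA_zmod.

Definition A_mul (a b : steenrod) : steenrod := toA (ofA a * ofA b).

Lemma toAM x y : A_mul (toA x) (toA y) = toA (x * y).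
Proof.
set x' := ofA (toA x); set y' := ofA (toA y); apply/toAP.
have hx : adem_ideal (x' - x) by apply/toAP; rewrite ofAK.
have hy : adem_ideal (y' - y) by apply/toAP; rewrite ofAK.
have -> : x' * y' - x * y = 1 * (x' - x) * y' - (- x) * (y' - y) * 1.
  by rewrite mul1r mulr1 mulrBl mulNr opprK mulrBr addrA subrK.
by apply: ai_sub; apply: ai_mul.
Qed.

Fact A_mulA : associative A_mul.
Proof. by move=> a b c; rewrite -(ofAK a) -(ofAK b) -(ofAK c) !toAM mulrA. Qed.
Fact A_mul1 : left_id (toA 1) A_mul.
Proof. by move=> a; rewrite -(ofAK a) toAM mul1r. Qed.
Fact A_mulr1 : right_id (toA 1) A_mul.
Proof. by move=> a; rewrite -(ofAK a) toAM mulr1. Qed.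
Fact A_mulDl : left_distributive A_mul +%R.
Proof.
by move=> a b c; rewrite -(ofAK a) -(ofAK b) -(ofAK c) -raddfD !toAM mulrDl raddfD.
Qed.
Fact A_mulDr : right_distributive A_mul +%R.
Proof.
by move=> a b c; rewrite -(ofAK a) -(ofAK b) -(ofAK c) -raddfD !toAM mulrDr raddfD.
Qed.
HB.instance Definition _ := GRing.Zmodule_isPzRing.Build steenrod
  A_mulA A_mul1 A_mulr1 A_mulDl A_mulDr.

Definition Sq (n : nat) : steenrod := toA (free_word [:: n]).

Definition wordA (w : word) : steenrod := \prod_(a <- w) Sq a.
Definition sumA (x : fsum) : steenrod := \sum_(w <- x) wordA w.

Definition homogA (n : nat) (a : steenrod) : Prop :=
  exists2 x : fsum, all (fun w => wdeg w == n) x & a = sumA x.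

(* a is zero in the quotient of A by the left ideal A Sq^1. *)
Definition in_ASq1 (a : steenrod) : Prop := exists b, a = b * Sq 1.

(* Milnor's Q_n, of degree 2^(n+1) - 1. *)
Fixpoint milnorQ (n : nat) : steenrod :=
  if n is n'.+1 then Sq (2 ^ n) * milnorQ n' + milnorQ n' * Sq (2 ^ n) else Sq 1.

(* milnorP n is the Milnor basis element dual to the square of xi_(n+1); the
   recursion is the Milnor product formula for its commutator with Sq^(2^(n+1)). *)
Fixpoint milnorP (n : nat) : steenrod :=
  if n is n'.+1 then
    Sq (2 ^ n.+1) * milnorP n' + milnorP n' * Sq (2 ^ n.+1)
    + Sq (2 ^ n.+1 - 1) * milnorQ n + milnorQ n' * milnorQ n * Sq (2 ^ n)
  else Sq 2.

(** * Nassau's D_0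

   D_0 is dual to the Hopf algebra Z/4[xi_k, 2 xi_(k,l)] of the series
     f(x) = sum_k xi_k x^(2^k) + sum_(k<l) 2 xi_(k,l) x^(2^k + 2^l),  xi_0 = 1,
   over Z/4 under composition. Substituting f for every variable, it acts on
   Z/4[x_0, x_1, ...]; the action is faithful, since the coefficients of
   x_0^(2^i0) x_1^(2^i1) ... and of x_0^(2^k + 2^l) x_1^(2^i1) ... in
   f(x_0) f(x_1) ... are xi_i0 xi_i1 ... and 2 xi_(k,l) xi_i1 .... So D_0 is
   realised here as an algebra of operators: the lift of Sq^n is dual to xi_1^n
   and Y_(k,l) is dual to 2 xi_(k,l). (Both indices of Y and U are one higher
   in the convention that starts at Y_(-1,0).) *)

Definition V := {malg 'Z_4[{cmonom nat}]}.

Definition xvar (i : nat) : V := << ucm i >>.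

(* The ring morphism x_i |-> x_i + x_i^2 t into V[t]. *)
Definition total_sq : V -> {poly V} :=
  mmap (polyC \o @malgC {cmonom nat} 'Z_4)
    (fun m : {cmonom nat} =>
       \prod_(i <- finsupp m) ((xvar i)%:P + xvar i ^+ 2 *: 'X) ^+ m i).

Definition Sq_op (n : nat) (p : V) : V := (total_sq p)`_n.

(* The derivation x_i |-> 2 x_i^(2^k + 2^l). *)
Definition Y_op (k l : nat) : V -> V :=
  mmap (@malgC {cmonom nat} 'Z_4)
    (fun m : {cmonom nat} => \sum_(i <- finsupp m)
       xvar i ^+ (2 ^ k + 2 ^ l - 1) * << m >> *+ (2 * m i)).

Inductive D0_gen : (V -> V) -> Prop :=
| D0_id : D0_gen id
| D0_Sq n : D0_gen (Sq_op n)
| D0_Y k l : D0_gen (Y_op k l)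
| D0_sub f g : D0_gen f -> D0_gen g -> D0_gen (fun p => f p - g p)
| D0_comp f g : D0_gen f -> D0_gen g -> D0_gen (f \o g).

Record D0 := MkD0 { D0_op :> V -> V; D0_opP : D0_gen D0_op }.

Lemma D0_eq (f g : D0) : D0_op f =1 D0_op g -> f = g.
Proof.
case: f g => [f fP] [g gP] /= /funext fg; case: _ / fg gP => gP.
by rewrite (Prop_irrelevance fP gP).
Qed.

Lemma D0_additive (f : D0) (p q : V) : f (p - q) = f p - f q.
Proof.
case: f p q => f /=; elim=> {f} //= [n|k l|f g _ IHf _ IHg|f g _ IHf _ IHg] p q.
- by rewrite /Sq_op /total_sq raddfB coefB.
- by rewrite /Y_op raddfB.
- by rewrite IHf IHg !opprD addrACA.
- by rewrite IHg IHf.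
Qed.

Fact D0_gen0 : D0_gen (fun=> 0).
Proof.
rewrite (_ : (fun=> 0) = (fun p => id p - id p)); last by apply/funext=> p; rewrite subrr.
by apply: D0_sub; exact: D0_id.
Qed.

Definition D0_zero : D0 := MkD0 D0_gen0.
Definition D0_opp (f : D0) : D0 := MkD0 (D0_sub D0_gen0 (D0_opP f)).
Definition D0_add (f g : D0) : D0 := MkD0 (D0_sub (D0_opP f) (D0_opP (D0_opp g))).
Definition D0_one : D0 := MkD0 D0_id.
Definition D0_mul (f g : D0) : D0 := MkD0 (D0_comp (D0_opP f) (D0_opP g)).

Lemma D0_addE f g p : D0_add f g p = f p + g p.
Proof. by rewrite /= sub0r opprK. Qed.

HB.instance Definition _ := gen_eqMixin D0.
HB.instance Definition _ := gen_choiceMixin D0.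

Fact D0_addA : associative D0_add.
Proof. by move=> f g h; apply: D0_eq => p; rewrite !D0_addE addrA. Qed.
Fact D0_addC : commutative D0_add.
Proof. by move=> f g; apply: D0_eq => p; rewrite !D0_addE addrC. Qed.
Fact D0_add0 : left_id D0_zero D0_add.
Proof. by move=> f; apply: D0_eq => p; rewrite !D0_addE add0r. Qed.
Fact D0_addN : left_inverse D0_zero D0_opp D0_add.
Proof. by move=> f; apply: D0_eq => p; rewrite !D0_addE /= sub0r addNr. Qed.
HB.instance Definition _ := GRing.isZmodule.Build D0 D0_addA D0_addC D0_add0 D0_addN.

Fact D0_mulA : associative D0_mul. Proof. by move=> f g h; apply: D0_eq. Qed.
Fact D0_mul1 : left_id D0_one D0_mul. Proof. by move=> f; apply: D0_eq. Qed.
Fact D0_mulr1 : right_id D0_one D0_mul. Proof. by move=> f; apply: D0_eq. Qed.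
Fact D0_mulDl : left_distributive D0_mul D0_add.
Proof. by move=> f g h; apply: D0_eq => p; rewrite D0_addE /= sub0r opprK. Qed.
Fact D0_mulDr : right_distributive D0_mul D0_add.
Proof.
move=> f g h; apply: D0_eq => p; rewrite [RHS]D0_addE /= !D0_additive.
have f0 : f 0 = 0 by have := D0_additive f 0 0; rewrite !subrr.
by rewrite f0 sub0r opprK.
Qed.
HB.instance Definition _ := GRing.Zmodule_isPzRing.Build D0
  D0_mulA D0_mul1 D0_mulr1 D0_mulDl D0_mulDr.

Definition SqD (n : nat) : D0 := MkD0 (D0_Sq n).
Definition YD (k l : nat) : D0 := MkD0 (D0_Y k l).

Definition wordD (w : word) : D0 := \prod_(a <- w) SqD a.
Definition sumD (x : fsum) : D0 := \sum_(w <- x) wordD w.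

(* [a, b], read in D_0. *)
Definition ademD (a b : nat) : D0 :=
  SqD a * SqD b + \sum_(k <- adem_idx a b) wordD (adem_pair a b k).

(* Some lift to D_0; 2 D_0 and Y_(k,l) D_0 only depend on classes in A. *)
Definition some_lift (a : steenrod) : D0 :=
  \sum_(w <- msupp (ofA a)) wordD w.

(* The admissible normal form, as the list of its monomials, and its lift. *)
Definition is_normal_form (a : steenrod) (x : fsum) : Prop :=
  [/\ uniq x, all admissible x & sumA x = a].
Definition normal_form (a : steenrod) : fsum :=
  classical_sets.xget [::] (is_normal_form a).
Definition adm_lift (a : steenrod) : D0 := sumD (normal_form a).

(** * Nassau's D_1

   As a right A-module D_1 is free on 1 (spanning the copy of A), mu_0 and the
   U_(k,l) with k < l. The left action of D_0 is given on generators by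
     a mu_0 = mu_0 a + kappa(a),
     a U_(k,l) = sum_(i,j) U_(k+i,l+j) (a contracted by xi_i^(2^k) xi_j^(2^l)),
   with kappa the contraction by xi_1, U_(l,k) = U_(k,l) + Q_(k-1) Q_(l-1) for
   0 < k < l, and U_(k,k) = mu_0 Q_k + (dual of xi_k^2) for k > 0, while 2 and
   Y_(k,l) act as 0. For a = Sq^n only i, j <= 1 contribute, so that the indices
   stay weakly increasing. *)

Definition D1_gen := option (option {p : nat * nat | (p.1 < p.2)%N}).
Definition g_one : D1_gen := None.
Definition g_mu : D1_gen := Some None.
Definition g_U p : D1_gen := Some (Some p).

Definition D1 := {malg steenrod[D1_gen]}.

Definition inA (a : steenrod) : D1 := << a *g g_one >>.
Definition mu0 (a : steenrod) : D1 := << a *g g_mu >>.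
(* U_(k,l) a for k <= l. *)
Definition U (k l : nat) (a : steenrod) : D1 :=
  if insub (k, l) is Some p then << a *g g_U p >>
  else mu0 (milnorQ k * a) + inA (milnorP k.-1 * a).

Definition bd_gen (g : D1_gen) : D0 :=
  match g with
  | None => 0
  | Some None => 2%:R
  | Some (Some p) => YD (val p).1 (val p).2
  end.

Definition bd (x : D1) : D0 := \sum_(g <- msupp x) bd_gen g * some_lift x@_g.

Definition Sq_minus (n d : nat) : steenrod := if (d <= n)%N then Sq (n - d) else 0.

Definition Sq_act_gen (n : nat) (g : D1_gen) (a : steenrod) : D1 :=
  match g with
  | None => inA (Sq n * a)
  | Some None => mu0 (Sq n * a) + inA (Sq_minus n 1 * a)
  | Some (Some p) => let: (k, l) := val p in
      U k l (Sq n * a) + U k.+1 l (Sq_minus n (2 ^ k) * a)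
      + U k l.+1 (Sq_minus n (2 ^ l) * a)
      + U k.+1 l.+1 (Sq_minus n (2 ^ k + 2 ^ l) * a)
  end.

Definition Sq_act (n : nat) (x : D1) : D1 :=
  \sum_(g <- msupp x) Sq_act_gen n g x@_g.

Definition word_act (al : word) (x : D1) : D1 := foldr Sq_act x al.

Definition act_word (x : D1) (be : word) : D1 :=
  \sum_(g <- msupp x) << x@_g * wordA be *g g >>.

(** * Tracked Adem reduction *)

(* Outcome of a reduction: formal sum of admissible words, track in D_1, and
   multiset of monomials a for which a duplicate a + a has been cancelled. *)
Record outcome := Outcome { terms : fsum; track : D1; cancelled : fsum }.

Section Reduction.
(* u a b is the secondary Adem track u[a, b]. *)
Variable u : nat -> nat -> D1.

(* Reduction of a word before cancellation among the final admissible words.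
   A term w_k that is not admissible occurs twice, in the relation that creates
   it and as the head of the relation that rewrites it, and is cancelled. *)
Inductive reduces : word -> outcome -> Prop :=
| reduces_adm w : admissible w -> reduces w (Outcome [:: w] 0 [::])
| reduces_step al a b be (r : nat -> outcome) :
    let wk k := al ++ adem_pair a b k ++ be in
    (0 < a < b.*2)%N -> admissible (rcons al a) ->
    (forall k, k \in adem_idx a b -> reduces (wk k) (r k)) ->
    reduces (al ++ [:: a, b & be])
      (Outcome
         (flatten [seq terms (r k) | k <- adem_idx a b])
         (word_act al (act_word (u a b) be) + \sum_(k <- adem_idx a b) track (r k))
         (flatten [seq (if admissible (wk k) then [::] else [:: wk k])
                         ++ cancelled (r k) | k <- adem_idx a b])).

(* The mod 2 sum of a list of words, and the pairs that cancel in it. *)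
Definition mod2 (x : fsum) : fsum := [seq w <- undup x | odd (count_mem w x)].
Definition mod2_pairs (x : fsum) : fsum :=
  flatten [seq nseq (count_mem w x)./2 w | w <- undup x].

(* Adm(x), T(x) and C(x). A word w of x that is already admissible has T(w) = 0
   and Adm(w) = w, so that w + Adm(w) = 0 also cancels a duplicate w + w. *)
Definition reduces_sum (x : fsum) (o : outcome) : Prop :=
  exists2 r : word -> outcome, (forall w, w \in x -> reduces w (r w)) &
    let l := flatten [seq terms (r w) | w <- x] in
    o = Outcome (mod2 l) (\sum_(w <- x) track (r w))
          ([seq w <- x | admissible w] ++ flatten [seq cancelled (r w) | w <- x]
             ++ mod2_pairs l).

End Reduction.

Definition That (o : outcome) : D1 :=
  track o + \sum_(w <- cancelled o) mu0 (wordA w).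

(** * The linear system *)

Fixpoint compositions (size_max n : nat) : seq word :=
  (if n == 0%N then [:: [::]] else [::]) ++
  (if size_max is s.+1 then
     [seq a :: w | a <- iota 1 n, w <- compositions s (n - a)] else [::]).

Definition adm_words (n : nat) : seq word :=
  [seq w <- compositions n n | admissible w].

(* The basis of degree m of A / A Sq^1. *)
Definition basisASq1 (m : nat) : seq word :=
  [seq w <- adm_words m | last 0%N w != 1%N].

(* The pairs (alpha, j) that index the columns. *)
Definition cols (m : nat) : seq (word * nat) :=
  [seq (al, j) | j <- [seq j <- iota 1 m | (2 ^ j < m)%N],
                 al <- adm_words (m - 2 ^ j)].

Definition col_word (p : word * nat) : word := rcons p.1 (2 ^ p.2)%N.

Definition coefs (m : nat) := 'rV['F_2]_(size (cols m)).

Definition chosen (m : nat) (c : coefs m) : seq (word * nat) :=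
  [seq tnth (in_tuple (cols m)) i | i <- enum 'I_(size (cols m)) & c 0 i != 0].

(* y_m *)
Definition ysum (m : nat) (c : coefs m) : fsum :=
  [:: m] :: [seq col_word p | p <- chosen c].

Definition solution (m : nat) (c : coefs m) : Prop :=
  in_ASq1 (Sq m + \sum_(p <- chosen c) wordA (col_word p)).

(* Coordinates in basisASq1; words ending in Sq^1 are discarded. *)
Definition coords (m : nat) (x : fsum) : 'rV['F_2]_(size (basisASq1 m)) :=
  \row_i (count_mem (nth [::] (basisASq1 m) i) x)%:R.

(* A run of the procedure reduces Sq^m and all the columns and solves the
   resulting system over F_2; it returns a solution or reports that none exists. *)
Definition procedure (u : nat -> nat -> D1) (m : nat) (out : option (coefs m)) :
    Prop :=
  exists (r0 : outcome) (r : 'I_(size (cols m)) -> outcome),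
    [/\ reduces u [:: m] r0,
        forall i, reduces u (col_word (tnth (in_tuple (cols m)) i)) (r i) &
        let v := coords m (terms r0) in
        let M := \matrix_i coords m (terms (r i)) in
        out = if (v <= M)%MS then Some (v *m pinvmx M) else None].

(** * The row d_1 *)

(* An element of the source of d_1: the formal sum of the alpha e_i over the
   pairs (alpha, i), plus b e_1. *)
Record row_elt := RowElt { even_part : seq (word * nat); e1_coef : steenrod }.

(* d_1, with e_i sent to the lift of Sq^i, read in D_0 with the word lift on the
   even part and the admissible lift of b Sq^1 on b e_1. *)
Definition d1 (r : row_elt) : D0 :=
  \sum_(p <- even_part r) wordD p.1 * SqD p.2 + adm_lift (e1_coef r * Sq 1).

Definition rsum (m : nat) (c : coefs m) : seq (word * nat) :=
  ([::], m) :: [seq (p.1, (2 ^ p.2)%N) | p <- chosen c].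

(* r_m + b e_1 *)
Definition rtilde (m : nat) (c : coefs m) (b : steenrod) : row_elt :=
  RowElt (rsum c) b.

(* Main.v *)
(* The operators of D_0 on V = Z/4[x_0, x_1, ...] satisfy the Adem relations modulo 2:
   every monomial is a product of variables, and the Cartan formula
   Sq(x p) = (x + x^2) Sq(p) reduces the relation on x p to relations on p. So A acts on
   V / 2; applied to products of distinct variables, this action shows that the
   admissible words are independent, and applied to x_0^m that Sq^m is indecomposable for
   m a power of 2. If m is not a power of 2, write m = a + 2^j with 0 < a < 2^j; then
   the relation [a, 2^j] expresses Sq^m through lower squares.

   The elements 2 and Y_(k,l) of D_0 kill lifts of 0 in A, and Sq^n commutes past Y_(k,l)
   as in the left action on D_1, so the boundary D_1 -> D_0 is a map of bimodules. A
   reduction step therefore changes the boundary of the track by alpha [a, b] beta; each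
   word that is created and then rewritten, and each cancelled pair, contributes twice
   the word, which the terms mu_0 correct because 4 = 0 in D_0. *)

From HB Require Import structures.
From mathcomp Require Import all_boot all_order all_algebra.
From mathcomp Require Import generic_quotient ring_quotient finmap boolp zify ring.
From mathcomp Require classical_sets.
From mathcomp.multinomials Require Import monalg.
Require Import Defs.

Set Implicit Arguments.
Unset Strict Implicit.
Unset Printing Implicit Defensive.

Import GRing.Theory.
Local Open Scope ring_scope.

(** Congruence modulo 2 is expressed throughout as equality of doubles ([eq2]). In V, which is free
    over Z/4, the kernel of doubling is 2 V. In D_0, two operators have equal doubles exactly when
    they agree on V / 2, and this is the right equivalence for three reasons: lifts from A to D_0
    are additive and multiplicative only up to it, left multiplication by 2 and by Y_(k,l) cannot
    see it, and admissible words stay independent modulo it. Thus no quotient of V or D_0 is formed,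
    while the final comparison of boundaries is an exact identity over Z/4. *)

Definition cmprod (S : comNzRingType) (e : nat -> S) (m : {cmonom nat}) : S :=
  \prod_(i <- finsupp m) e i ^+ m i.

Lemma cmprodEw (S : comNzRingType) (e : nat -> S) (m : {cmonom nat})
    (d : {fset nat}) :
  (finsupp m `<=` d)%fset -> cmprod e m = \prod_(i <- d) e i ^+ m i.
Proof.
move=> le; rewrite /cmprod (big_fset_incl _ le) //.
by move=> i _; rewrite -cmE_neq0 negbK => /eqP->; rewrite expr0.
Qed.

Fact cmprod_morph (S : comNzRingType) (e : nat -> S) : mmorphism (cmprod e).
Proof.
split=> [m1 m2|]; last by rewrite /cmprod mdom1 big_seq_fset0.
rewrite {1}/cmprod mdomD (cmprodEw _ (fsubsetUl _ (finsupp m2))).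
rewrite (cmprodEw _ (fsubsetUr (finsupp m1) _)) -big_split /=.
by apply: eq_bigr => i _; rewrite cmM exprD.
Qed.
HB.instance Definition _ (S : comNzRingType) (e : nat -> S) :=
  isMultiplicative.Build _ _ (cmprod e) (cmprod_morph e).

Lemma cmprod_ucm (S : comNzRingType) (e : nat -> S) i : cmprod e (ucm i) = e i.
Proof. by rewrite /cmprod mdomU big_seq_fset1 cmUU expr1. Qed.

Definition Veval (S : comNzRingType) (f : {rmorphism 'Z_4 -> S}) (e : nat -> S) :
  {rmorphism V -> S} := mmap f (cmprod e).

Lemma Veval_xvar (S : comNzRingType) (f : {rmorphism 'Z_4 -> S}) (e : nat -> S) i :
  Veval f e (xvar i) = e i.
Proof.
rewrite /= mmapU /=; have := rmorph1 f; rewrite /= => ->; rewrite mul1r.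
exact: cmprod_ucm.
Qed.

(** Scalars need no clause of their own, since every coefficient in Z/4 is a natural multiple of 1.
    A monomial is reached by induction on its degree, splitting off one variable. *)
Lemma Vind (P : V -> Prop) :
  P 1 -> (forall p q, P p -> P q -> P (p - q)) ->
  (forall i p, P p -> P (xvar i * p)) -> forall p, P p.
Proof.
move=> P1 PB PX.
have P0 : P 0 by rewrite -(subrr 1); apply: PB.
have PN p : P p -> P (- p) by move=> Pp; rewrite -sub0r; apply: PB.
have PD p q : P p -> P q -> P (p + q).
  by move=> Pp Pq; rewrite -[q]opprK; apply: PB => //; apply: PN.
have PU (m : {cmonom nat}) : P << m >>.
  have [n] := ubnP (mdeg m).
  elim: n m => [|n IH] m mn.
    by exfalso; move: mn; rewrite ltn0.
  have [->|m1] := eqVneq m mone; first exact: P1.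
  have [i im] : exists i, m i != 0%N.
    apply: contrapT => mi; case/eqP: m1; apply/eqP/cmP => i; rewrite cm1.
    by apply/eqP/negPn/negP => im; apply: mi; exists i.
  have em : m = mmul (ucm i) (divcm m (ucm i)).
    apply/eqP/cmP => j; rewrite cmM divcmE ucmE.
    by case: eqP => [<-|]; rewrite ?add0n ?subn0 ?subnKC ?lt0n.
  have -> : << m >> = xvar i * << divcm m (ucm i) >> :> V.
    by rewrite malgM_def fgmulUU mul1r -em.
  apply: PX; apply: IH; move: mn; rewrite {1}em mdegM mdegU.
  by rewrite add1n ltnS.
move=> p; rewrite [p]monalgE; elim/big_ind: _ => [||m _]; [exact: P0|exact: PD|].
have -> : << p@_m *g m >> = << m >> *+ val p@_m :> V.
  by rewrite -raddfMn /= -[p@_m in LHS]natr_Zp.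
elim: (val _) => [|n IH]; first by rewrite mulr0n.
rewrite mulrS; apply: PD; [exact: PU|exact: IH].
Qed.

Lemma Vmorph_eq (S : pzRingType) (f g : {rmorphism V -> S}) :
  (forall i, f (xvar i) = g (xvar i)) -> f =1 g.
Proof.
move=> fg; elim/Vind=> [|p q fp fq|i p fp]; first by rewrite !rmorph1.
  by rewrite !rmorphB fp fq.
by rewrite !rmorphM fg fp.
Qed.

Lemma V_mul4 (p : V) : p *+ 4 = 0.
Proof.
have V4 : 4%:R = 0 :> V by rewrite -mpolyC_nat (_ : 4%:R = 0) ?malgC0E //; apply/eqP.
by rewrite -mulr_natr V4 mulr0.
Qed.

(** * The total square and the Cartan formula *)

Lemma total_sqE :
  total_sq = Veval (polyC \o @malgC {cmonom nat} 'Z_4)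
    (fun i => (xvar i)%:P + xvar i ^+ 2 *: 'X).
Proof. by []. Qed.

Fact total_sq_zmod : zmod_morphism total_sq.
Proof. by move=> p q; rewrite total_sqE rmorphB. Qed.
HB.instance Definition _ := GRing.isZmodMorphism.Build V {poly V} total_sq total_sq_zmod.
Fact total_sq_mul : monoid_morphism total_sq.
Proof. by rewrite total_sqE; split; [exact: rmorph1|exact: rmorphM]. Qed.
HB.instance Definition _ := GRing.isMonoidMorphism.Build V {poly V} total_sq total_sq_mul.

Lemma total_sq_xvar i : total_sq (xvar i) = (xvar i)%:P + xvar i ^+ 2 *: 'X.
Proof. exact: Veval_xvar. Qed.

Fact Sq_op_zmod n : zmod_morphism (Sq_op n).
Proof. by move=> p q; rewrite /Sq_op raddfB coefB. Qed.
HB.instance Definition _ n := GRing.isZmodMorphism.Build V V (Sq_op n) (Sq_op_zmod n).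

(* Sq^(n-d), with an offset so that the Cartan formula [sqX] needs no truncated
   subtraction. *)
Definition sq (n d : nat) (p : V) : V := if (d <= n)%N then Sq_op (n - d) p else 0.

Lemma sqE n d p : sq n d p = ('X^d * total_sq p)`_n.
Proof. by rewrite /sq /Sq_op coefXnM ltnNge; case: (d <= n)%N. Qed.

Fact sq_zmod n d : zmod_morphism (sq n d).
Proof. by move=> p q; rewrite !sqE raddfB mulrBr coefB. Qed.
HB.instance Definition _ n d := GRing.isZmodMorphism.Build V V (sq n d) (sq_zmod n d).

Lemma sq0 n p : sq n 0 p = Sq_op n p.
Proof. by rewrite /sq subn0. Qed.

Lemma sqSS n d p : sq n.+1 d.+1 p = sq n d p.
Proof. by rewrite /sq ltnS subSS. Qed.

Lemma sqD n d e p : sq (n + d) (e + d) p = sq n e p.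
Proof. by rewrite /sq leq_add2r subnDr. Qed.

Lemma sq0S d p : sq 0 d.+1 p = 0.
Proof. by []. Qed.

Lemma sq1 n d : sq n d 1 = (n == d)%:R.
Proof. by rewrite sqE rmorph1 mulr1 coefXn. Qed.

Lemma sqX n d i p : sq n d (xvar i * p) = xvar i * sq n d p + xvar i ^+ 2 * sq n d.+1 p.
Proof.
rewrite !sqE rmorphM /= total_sq_xvar mulrDl mulrDr coefD; congr (_ + _).
  by rewrite mulrCA coefCM.
by rewrite -scalerAl -scalerAr coefZ mulrA -exprSr.
Qed.

Lemma Sq_op1 n : Sq_op n 1 = (n == 0)%:R.
Proof. by rewrite -sq0 sq1. Qed.

Lemma Sq_opX n i p : Sq_op n (xvar i * p) = xvar i * Sq_op n p + xvar i ^+ 2 * sq n 1 p.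
Proof. by rewrite -!sq0 sqX. Qed.

Lemma Sq_op0 p : Sq_op 0 p = p.
Proof.
elim/Vind: p => [|p q hp hq|i p hp]; first by rewrite Sq_op1 eqxx.
  by rewrite raddfB /= hp hq.
by rewrite Sq_opX hp sq0S mulr0 addr0.
Qed.

(** Frobenius modulo 2: squaring the formula for k doubles the cross term, which the outer factor 2
    turns into a multiple of 4. *)
Lemma total_sq_xvar_pow i k :
  total_sq (xvar i ^+ (2 ^ k)) *+ 2
  = ((xvar i ^+ (2 ^ k))%:P + xvar i ^+ (2 ^ k.+1) *: 'X^(2 ^ k)) *+ 2.
Proof.
elim: k => [|k IH]; first by rewrite !expr1 total_sq_xvar.
have sqr2 (S : comNzRingType) (a b : S) : a *+ 2 = b *+ 2 -> a ^+ 2 *+ 2 = b ^+ 2 *+ 2.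
  by move=> ab; rewrite !expr2 -mulrnAr ab mulrnAr -mulrnAl ab mulrnAl.
have P4 (P : {poly V}) : P *+ 4 = 0 by apply/polyP => j; rewrite coefMn V_mul4 coef0.
rewrite [in LHS]expnSr exprM rmorphXn /= (sqr2 _ _ _ IH) sqrrD addrAC.
rewrite [LHS]mulrnDl -[_ *+ 2 *+ 2]mulrnA P4 addr0 -rmorphXn /= exprZn -!exprM.
by rewrite -!expnSr.
Qed.

Lemma sq_xvar_pow n d i k p :
  sq n d (xvar i ^+ (2 ^ k) * p) *+ 2
  = (xvar i ^+ (2 ^ k) * sq n d p + xvar i ^+ (2 ^ k.+1) * sq n (d + 2 ^ k) p) *+ 2.
Proof.
rewrite !sqE -coefMn -mulrnAr rmorphM /= -mulrnAl total_sq_xvar_pow mulrnAl mulrnAr.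
rewrite coefMn mulrDl mulrDr coefD mulrCA coefCM -scalerAl -scalerAr coefZ.
by rewrite mulrA -exprD.
Qed.

(* With C(-1, n) = 1 the relation also holds, trivially, for a = 2b and a = 2b + 1;
   these cases occur in the induction. *)
Definition adem_coef (a b k : nat) : bool :=
  (k.*2 <= a)%N && ((b <= k)%N || odd 'C(b - k - 1, a - k.*2)).

(** Pascal's rule: with n = b - k - 1 and j = a - 2k - 1, both sides are C(n, j) + C(n, j+1) + C(n,
    j+2) modulo 2. The cases 2k = a and 2k = a + 1 at the end of the range are checked separately.
    The identity matches the coefficients of x^2 when an Adem relation is applied to x p. *)
Lemma adem_coef_pascal a b k : (a.+1 < b.+1.*2)%N ->
  adem_coef a.+1 b.+1 k (+) adem_coef a.+1 b.+1 k.+1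
  = adem_coef a b.+1 k (+) adem_coef a.+1 b k.
Proof.
move=> ab; rewrite /adem_coef doubleS subSS.
have [ka|ka] := leqP k.*2.+2 a.+1.
  have [j ->] : exists j, a = (k.*2 + j.+1)%N by exists (a - k.*2.+1)%N; lia.
  have [n ->] : exists n, b = (k + n.+1)%N by exists (b - k.+1)%N; lia.
  do !(case: leqP => [?|?]; try lia); rewrite /=.
  rewrite (_ : _.+1 - k - 1 = n.+1)%N; last lia.
  rewrite (_ : _ - k - 1 = n)%N; last lia.
  rewrite (_ : _.+1 - k.*2 = j.+2)%N; last lia.
  rewrite (_ : _ - k.*2.+2 = j)%N; last lia.
  rewrite (_ : _ - k.*2 = j.+1)%N; last lia.
  by rewrite !binS !oddD; case: (odd 'C(n, j.+2)) (odd 'C(n, j.+1)) (odd 'C(n, j)) => [] [] [].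
rewrite /= addbF.
have [ka1|ka1] := ltnP k.*2 a.+1.
  have -> : a = k.*2 by lia.
  rewrite leqnn subSnn subnn bin0 bin1 orbT /=.
  have -> : (b < k)%N = false by lia.
  have [bk|bk] := leqP b k; first by rewrite (_ : (b.+1 - k - 1)%N = 0%N) //; lia.
  rewrite (_ : (b.+1 - k - 1)%N = (b - k - 1).+1) /=; last lia.
  by rewrite leqnSn bin1.
have [ka2|ka2] := leqP k.*2 a.+1; last by rewrite (_ : (k.*2 <= a)%N = false) //; lia.
have -> : a.+1 = k.*2 by lia.
by rewrite subnn !bin0 !orbT (_ : (k.*2 <= a)%N = false) //; lia.
Qed.

Lemma adem_coefSS a b k : adem_coef a.+2 b.+1 k.+1 = adem_coef a b k.
Proof. by rewrite /adem_coef doubleS !ltnS !subSS. Qed.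

Definition eq2 (U : zmodType) (p q : U) := p *+ 2 = q *+ 2.

Lemma eq2D (U : zmodType) (p q p' q' : U) : eq2 p q -> eq2 p' q' -> eq2 (p + p') (q + q').
Proof. by rewrite /eq2 !mulrnDl => -> ->. Qed.

Lemma eq2_sum (U : zmodType) I (r : seq I) (F G : I -> U) :
  (forall i, eq2 (F i) (G i)) -> eq2 (\sum_(i <- r) F i) (\sum_(i <- r) G i).
Proof. by move=> FG; rewrite /eq2 -!sumrMnl; apply: eq_bigr => i _; exact: FG. Qed.

Lemma eq2Mn (U : zmodType) (p q : U) n : eq2 p q -> eq2 (p *+ n) (q *+ n).
Proof. by rewrite /eq2 mulrnAC => ->; rewrite mulrnAC. Qed.

Lemma eq2Ml (S : pzRingType) (p q r : S) : eq2 p q -> eq2 (r * p) (r * q).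
Proof. by rewrite /eq2 => pq; rewrite -mulrnAr pq mulrnAr. Qed.

(** * The Adem relations on polynomials modulo 2 *)

Section AdemAction.

(** W stands for V and [sq n d] for Sq^(n-d). Only the values at 1, the Cartan formula for a
    variable and the dependence on n - d enter the argument. *)
Variables (W : comNzRingType) (x : nat -> W) (sq : nat -> nat -> {additive W -> W}).

Hypothesis W_mul4 : forall p : W, p *+ 4 = 0.
Hypothesis Wind : forall P : W -> Prop, P 1 -> (forall p q, P p -> P q -> P (p - q)) ->
  (forall i p, P p -> P (x i * p)) -> forall p, P p.
Hypothesis sq1 : forall n d, sq n d 1 = (n == d)%:R.
Hypothesis sqX : forall n d i p,
  sq n d (x i * p) = x i * sq n d p + x i ^+ 2 * sq n d.+1 p.
Hypothesis sqD : forall n d e p, sq (n + d) (e + d) p = sq n e p.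
Hypothesis sq0S : forall d p, sq 0 d.+1 p = 0.

Let sqSS n d p : sq n.+1 d.+1 p = sq n d p.
Proof. by rewrite -addn1 -(addn1 d) sqD. Qed.

Let sq00 p : sq 0 0 p = p.
Proof.
elim/Wind: p => [|p q hp hq|i p hp]; first by rewrite sq1.
  by rewrite raddfB hp hq.
by rewrite sqX hp sq0S mulr0 addr0.
Qed.

Lemma eq2_odd (p : W) n : eq2 (p *+ n) (p *+ odd n).
Proof.
rewrite /eq2 -[n in LHS]odd_double_half mulrnDr mulrnDl -[X in _ + X]mulrnA.
by rewrite (_ : (_ * 2 = 4 * n./2)%N) ?mulrnA ?W_mul4 ?mul0rn ?addr0 //; lia.
Qed.

(** [N] is any bound above [a]: the terms with 2k > a vanish, so one bound can serve the relations
    with smaller [a] and [b] that arise in the induction. *)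
Definition adem_op (N a b : nat) (p : W) : W :=
  sq a 0 (sq b 0 p) + \sum_(k < N) sq (a + b) k (sq k 0 p) *+ adem_coef a b k.

(** A single index survives, k = 0 for a = 0 and k = b otherwise, and its term is Sq^a Sq^b itself;
    the total is a double. *)
Lemma adem_op_trivial N a b p :
  (a < N)%N -> a = 0%N \/ (b.*2 <= a <= b.*2.+1)%N -> eq2 (adem_op N a b p) 0.
Proof.
move=> aN ab; rewrite /adem_op.
have [k [kN ck]] : exists k, (k < N)%N /\
    forall j, adem_coef a b j = (j == k) /\ sq (a + b) k (sq k 0 p) = sq a 0 (sq b 0 p).
  case: ab => [a0|ab].
    exists 0%N; split=> [|j]; first lia; subst a.
    rewrite /adem_coef add0n !sq00; split=> //.
    by case: j => [|j] //=; rewrite subnn bin0 orbT.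
  exists b; split=> [|j]; first lia.
  split; last by rewrite -[X in sq _ X _]add0n sqD.
  rewrite /adem_coef; case: (leqP b j) => bj /=; last first.
    rewrite bin_small; last by lia.
    by rewrite andbF; apply/esym/eqP => jb; move: bj; rewrite jb ltnn.
  by lia.
rewrite (bigD1 (Ordinal kN)) //= big1 => [|j jk]; last first.
  by rewrite (ck j).1 -val_eqE /= in jk *; rewrite (negbTE jk).
by rewrite (ck k).1 eqxx mulr1n (ck k).2 addr0 /eq2 mul0rn -mulr2n -mulrnA W_mul4.
Qed.

(** Two applications of the Cartan formula give the term in x^3 twice. *)
Lemma eq2_sqX2 n d i p :
  eq2 (sq n d (x i ^+ 2 * p)) (x i ^+ 2 * sq n d p + x i ^+ 4 * sq n d.+2 p).
Proof. by rewrite /eq2 expr2 -mulrA !sqX -[RHS]addr0 -(W_mul4 (x i ^+ 3 * sq n d.+1 p)); ring. Qed.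

Lemma sq_sqX n d e i m p :
  eq2 (sq n d (sq m e (x i * p)))
      (x i * sq n d (sq m e p)
       + x i ^+ 2 * (sq n d.+1 (sq m e p) + sq n d (sq m e.+1 p))
       + x i ^+ 4 * sq n d.+2 (sq m e.+1 p)).
Proof.
rewrite sqX raddfD /= sqX mulrDr -!addrA; do 2!apply: eq2D => //.
exact: eq2_sqX2.
Qed.

(* Write R(a,b) for [adem_op]. In R(a,b)(x p) the coefficients of x, x^2 and x^4 are
   R(a,b) p, R(a-1,b) p + R(a,b-1) p and R(a-2,b-1) p. *)
Lemma adem_op_eq0 N a b p : (a < N)%N -> (a <= b.*2.+1)%N -> eq2 (adem_op N a b p) 0.
Proof.
elim/Wind: p N a b => [|p q hp hq|i p IH] N a b aN ab.
- have [->|a0] := eqVneq a 0%N; first by apply: adem_op_trivial; [lia|left].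
  rewrite /adem_op sq1 big1 => [|k _]; last first.
    rewrite sq1; case: eqP => [k0|_]; last by rewrite raddf0 mul0rn.
    by rewrite k0 sq1 addn_eq0 (negbTE a0) mul0rn.
  by case: (b == 0%N); rewrite ?sq1 ?(negbTE a0) ?raddf0 addr0.
- rewrite /adem_op !raddfB /=.
  have -> : \sum_(k < N) sq (a + b) k (sq k 0 (p - q)) *+ adem_coef a b k
    = \sum_(k < N) sq (a + b) k (sq k 0 p) *+ adem_coef a b k
      - \sum_(k < N) sq (a + b) k (sq k 0 q) *+ adem_coef a b k.
    by rewrite -sumrB; apply: eq_bigr => k _; rewrite !raddfB mulrnBl.
  rewrite addrACA -opprD /eq2 mulrnBl mul0rn.
  by rewrite (hp N a b aN ab) (hq N a b aN ab) subrr.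
case: a aN ab => [|a] aN ab; first by apply: adem_op_trivial; [lia|left].
have [ab2|ab2] := leqP b.*2 a.+1; first by apply: adem_op_trivial => //; right; lia.
case: b ab ab2 => [|b] ab ab2; first by [].
have sumX : eq2 (adem_op N a.+1 b.+1 (x i * p))
   (x i * adem_op N a.+1 b.+1 p
    + x i ^+ 2 * (adem_op N a b.+1 p + adem_op N a.+1 b p)
    + x i ^+ 4 * (if a is a'.+1 then adem_op N.-1 a' b p else 0)).
  set s := (a.+1 + b.+1)%N; pose c := adem_coef a.+1 b.+1.
  pose B k := sq s k.+1 (sq k 0 p) *+ c k + sq s k (sq k 1 p) *+ c k.
  pose D k := sq s k.+2 (sq k 1 p) *+ c k.
  rewrite /eq2 [LHS](_ : _ = (
      x i * adem_op N a.+1 b.+1 p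
      + x i ^+ 2 * (sq a 0 (sq b.+1 0 p) + sq a.+1 0 (sq b 0 p) + \sum_(k < N) B k)
      + x i ^+ 4 * (sq a.+1 2 (sq b.+1 1 p) + \sum_(k < N) D k)) *+ 2); last first.
    rewrite [RHS](_ : _ = (x i * sq a.+1 0 (sq b.+1 0 p)
       + x i ^+ 2 * (sq a.+1 1 (sq b.+1 0 p) + sq a.+1 0 (sq b.+1 1 p))
       + x i ^+ 4 * sq a.+1 2 (sq b.+1 1 p)) *+ 2 +
       (\sum_(k < N) (x i * sq s k (sq k 0 p)
       + x i ^+ 2 * (sq s k.+1 (sq k 0 p) + sq s k (sq k 1 p))
       + x i ^+ 4 * sq s k.+2 (sq k 1 p)) *+ c k) *+ 2).
      rewrite /adem_op -/s mulrnDl; congr (_ + _); first exact: sq_sqX.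
      by apply: eq2_sum => k; apply: eq2Mn; apply: sq_sqX.
    rewrite -mulrnDl; congr (_ *+ 2); rewrite /adem_op -/s !sqSS.
    rewrite [X in _ = _ + X](_ : _ = x i * (\sum_(k < N) sq s k (sq k 0 p) *+ c k)
      + x i ^+ 2 * (\sum_(k < N) B k) + x i ^+ 4 * (\sum_(k < N) D k)); first by ring.
    rewrite !mulr_sumr -!big_split /=; apply: eq_bigr => k _.
    by rewrite /B /D !mulrnDl !mulrDr !mulrnAr mulrnDl.
  (* Since [sq s k.+1 (sq k.+1 1 p)] equals [sq s.-1 k (sq k 0 p)], shifting the index in the second
     half of [B] merges the two halves, with coefficient c k + c (k + 1); then Pascal's rule
     applies. *)
  have EB : eq2 (\sum_(k < N) B k)
      (\sum_(k < N) sq (a + b.+1) k (sq k 0 p) *+ adem_coef a b.+1 k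
       + \sum_(k < N) sq (a.+1 + b) k (sq k 0 p) *+ adem_coef a.+1 b k).
    have -> : \sum_(k < N) B k
        = \sum_(k < N) sq (a + b.+1) k (sq k 0 p) *+ (c k + c k.+1).
      rewrite big_split /=; under [RHS]eq_bigr => k _ do rewrite mulrnDr.
      rewrite [RHS]big_split /=; congr (_ + _); first by apply: eq_bigr => k _; rewrite sqSS.
      case: N aN {B D} => // N aN; rewrite big_ord_recl big_ord_recr /= sq0S raddf0 mul0rn add0r.
      have -> : c N.+1 = false by rewrite /c /adem_coef; lia.
      by rewrite addr0; apply: eq_bigr => k _; rewrite !sqSS.
    rewrite -big_split /=; apply: eq2_sum => k; rewrite addSnnS -mulrnDr.
    apply: etrans (eq2_odd _ _) (etrans _ (esym (eq2_odd _ _))).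
    by rewrite !oddD !oddb adem_coef_pascal.
  have ED : sq a.+1 2 (sq b.+1 1 p) + \sum_(k < N) D k
      = if a is a'.+1 then adem_op N.-1 a' b p else 0.
    rewrite /D /c /s {EB B D c s}.
    case: N aN => // N aN; rewrite big_ord_recl sq0S raddf0 mul0rn add0r /=.
    case: a aN ab ab2 => [|a] aN ab ab2.
      by rewrite sqSS sq0S add0r big1.
    rewrite !sqSS /adem_op; congr (_ + _); apply: eq_bigr => k _.
    by rewrite adem_coefSS !addSn addnS !sqSS.
  rewrite ED; apply: eq2D => //; apply: eq2D => //; apply: eq2Ml.
  by rewrite /adem_op addrACA; apply: eq2D.
rewrite /eq2 sumX mul0rn.
have Z r n (q : W) : eq2 q 0 -> (r ^+ n * q) *+ 2 = 0 :> W.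
  by move=> q0; rewrite -mulrnAr q0 mul0rn mulr0.
rewrite !mulrnDl -[x i in X in X + _ + _]expr1 !Z ?addr0 //.
- by case: a aN ab ab2 {sumX} => // a aN ab ab2; apply: IH; lia.
- by rewrite -[0]addr0; apply: eq2D; apply: IH; lia.
- by apply: IH; lia.
Qed.

End AdemAction.

(** * Moving squares past the derivations Y *)

Section SqYCommutation.

Variables (W : comNzRingType) (x : nat -> W) (sq Y : nat -> nat -> {additive W -> W}).

Hypothesis W_mul4 : forall p : W, p *+ 4 = 0.
Hypothesis Wind : forall P : W -> Prop, P 1 -> (forall p q, P p -> P q -> P (p - q)) ->
  (forall i p, P p -> P (x i * p)) -> forall p, P p.
Hypothesis sq1 : forall n d, sq n d 1 = (n == d)%:R.
Hypothesis sqX : forall n d i p,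
  sq n d (x i * p) = x i * sq n d p + x i ^+ 2 * sq n d.+1 p.
Hypothesis eq2_sqXn : forall n d i k p,
  eq2 (sq n d (x i ^+ (2 ^ k) * p))
      (x i ^+ (2 ^ k) * sq n d p + x i ^+ (2 ^ k.+1) * sq n (d + 2 ^ k) p).
Hypothesis Y1 : forall k l, Y k l 1 = 0.
Hypothesis YX : forall k l i p,
  Y k l (x i * p) = (x i ^+ (2 ^ k) * x i ^+ (2 ^ l) * p) *+ 2 + x i * Y k l p.

Let YX2 k l i p : Y k l (x i ^+ 2 * p) = x i ^+ 2 * Y k l p.
Proof.
rewrite expr2 -mulrA !YX -[RHS]addr0.
by rewrite -(W_mul4 (x i * (x i ^+ (2 ^ k) * x i ^+ (2 ^ l) * p))); ring.
Qed.

(** The four terms are those of (x^(2^k) + x^(2^(k+1)) t^(2^k)) (x^(2^l) + x^(2^(l+1)) t^(2^l)),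
    which modulo 2 is the total square of x^(2^k + 2^l), half of the value of Y_(k,l) on x. The rest
    of the Leibniz rule goes through by induction because Y commutes with multiplication by x^2. *)
Lemma sq_Y n d k l p :
  sq n d (Y k l p)
  = Y k l (sq n d p) + Y k.+1 l (sq n (d + 2 ^ k) p) + Y k l.+1 (sq n (d + 2 ^ l) p)
    + Y k.+1 l.+1 (sq n (d + 2 ^ k + 2 ^ l) p).
Proof.
elim/Wind: p d => [|p q hp hq|i p IH] d.
- by rewrite Y1 raddf0 !sq1 !raddfMn /= !Y1 !mul0rn !addr0.
- by rewrite !raddfB hp hq; ring.
have E : sq n d (x i ^+ (2 ^ k) * x i ^+ (2 ^ l) * p) *+ 2 =
  (x i ^+ (2 ^ k) * x i ^+ (2 ^ l) * sq n d p
   + x i ^+ (2 ^ k.+1) * x i ^+ (2 ^ l) * sq n (d + 2 ^ k) p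
   + x i ^+ (2 ^ k) * x i ^+ (2 ^ l.+1) * sq n (d + 2 ^ l) p
   + x i ^+ (2 ^ k.+1) * x i ^+ (2 ^ l.+1) * sq n (d + 2 ^ k + 2 ^ l) p) *+ 2.
  rewrite -[X in sq n d X]mulrA [LHS]eq2_sqXn.
  have := eq2D (eq2Ml (x i ^+ (2 ^ k)) (eq2_sqXn n d i l p))
    (eq2Ml (x i ^+ (2 ^ k.+1)) (eq2_sqXn n (d + 2 ^ k) i l p)).
  by rewrite /eq2 => ->; ring.
rewrite YX raddfD /= raddfMn /= E sqX !IH !sqX.
rewrite ![Y _ _ (_ + _)]raddfD /= !YX !YX2 !addSn; ring.
Qed.

(** Both sides are derivations with value 2 x^2 on a variable x. *)
Lemma Y00 p : (forall q, sq 1 1 q = q) -> Y 0 0 p = sq 1 0 p *+ 2.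
Proof.
move=> sq11; elim/Wind: p => [|p q hp hq|i p IH].
- by rewrite Y1 sq1 mul0rn.
- by rewrite !raddfB /= hp hq mulrnBl.
by rewrite YX IH sqX sq11 expr1 -expr2; ring.
Qed.

End SqYCommutation.

(** * Y as twice a derivation *)

Lemma malgU_mul (K : monomType) (R : nzRingType) (c d : R) (k1 k2 : K) :
  << c *g k1 >> * << d *g k2 >> = << c * d *g mmul k1 k2 >> :> {malg R[K]}.
Proof. by rewrite malgM_def fgmulUU. Qed.

Lemma malgU1_mul (K : monomType) (R : nzRingType) (d : R) (k1 k2 : K) :
  << k1 >> * << d *g k2 >> = << d *g mmul k1 k2 >> :> {malg R[K]}.
Proof. by rewrite malgU_mul mul1r. Qed.

Lemma malgU_C (K : monomType) (R : nzRingType) (c : R) (k : K) :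
  << c *g k >> = c%:MP * << k >> :> {malg R[K]}.
Proof. by rewrite malgU_mul mulr1 mul1m. Qed.

Lemma exprp1 (S : pzRingType) (y : S) e : (0 < e)%N -> y ^+ (e - 1) * y = y ^+ e.
Proof. by move=> e0; rewrite -exprSr subn1 prednK. Qed.

(** The Leibniz rule on one monomial, for [mderivX]: y is the variable x_i, M a monomial with
    exponents n, e j the factor x_j^(e-1), and z = x_i^e. The summand [i == j] of the exponent
    accounts for differentiating the new factor y. *)
Lemma leibniz_sum (S : comNzRingType) (d : {fset nat}) (i : nat) (c y z M : S)
    (e : nat -> S) (n : nat -> nat) : e i * y = z -> i \in d ->
  c * (\sum_(j <- d) e j * (y * M) *+ ((i == j) + n j))
  = z * (c * M) + y * (c * (\sum_(j <- d) e j * M *+ n j)).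
Proof.
move=> <- di; under eq_bigr => j _ do rewrite mulrnDr.
rewrite big_split /= mulrDr; congr (_ + _).
  rewrite (big_fsetD1 i) //= eqxx mulr1n big1_fset => [|j]; last first.
    by rewrite !inE eq_sym => /andP[/negPf-> _] _; rewrite mulr0n.
  by rewrite addr0; ring.
rewrite mulrCA; congr (_ * _); rewrite mulr_sumr; apply: eq_bigr => j _.
by rewrite mulrCA mulrnAr.
Qed.

Lemma mmap_malgCU (R : comNzRingType) (h : {cmonom nat} -> {malg R[{cmonom nat}]}) c m :
  mmap (@malgC {cmonom nat} R) h << c *g m >> = c%:MP * h m.
Proof. exact: (@mmapU _ _ _ (@malgC {cmonom nat} R) h c m). Qed.

(* The derivation x_i |-> x_i^e; half of [Y_op] is of this form, which makes [Y_op]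
   factor through V / 2. *)
Definition mderiv (R : comNzRingType) (e : nat) :
    {malg R[{cmonom nat}]} -> {malg R[{cmonom nat}]} :=
  mmap (@malgC {cmonom nat} R)
    (fun m : {cmonom nat} =>
       \sum_(i <- finsupp m) << ucm i >> ^+ (e - 1) * << m >> *+ m i).

Fact mderiv_zmod (R : comNzRingType) e : zmod_morphism (@mderiv R e).
Proof. by move=> p q; rewrite /mderiv raddfB. Qed.
HB.instance Definition _ (R : comNzRingType) e :=
  GRing.isZmodMorphism.Build _ _ (@mderiv R e) (@mderiv_zmod R e).

(** The index set [d] may exceed the support, so that the sums for m and for x_i m can run over the
    same set. *)
Lemma mderivU (R : comNzRingType) e (c : R) (m : {cmonom nat}) M d :
  M = << m >> -> (finsupp m `<=` d)%fset ->
  mderiv e << c *g m >> = c%:MP * (\sum_(i <- d) << ucm i >> ^+ (e - 1) * M *+ m i).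
Proof.
move=> ->; move=> le; rewrite -(big_fset_incl _ le); first exact: mmap_malgCU.
by move=> i _; rewrite -cmE_neq0 negbK => /eqP->; rewrite mulr0n.
Qed.

Lemma mderivX (R : comNzRingType) (e i : nat) (p : {malg R[{cmonom nat}]}) :
  (0 < e)%N -> mderiv e (<< ucm i >> * p) = << ucm i >> ^+ e * p + << ucm i >> * mderiv e p.
Proof.
move=> e0; rewrite [p]monalgE mulr_sumr !raddf_sum /= !mulr_sumr -big_split /=.
apply: eq_bigr => m _; move: (p@_m) => c.
rewrite [X in mderiv e X = _](malgU1_mul c (ucm i) m).
set d := finsupp (mmul (ucm i) m).
have di : i \in d by rewrite /d mdomD mdomU !inE eqxx.
have dm : (finsupp m `<=` d)%fset by rewrite /d mdomD fsubsetUr.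
apply: (etrans (mderivU e c (malgU1_mul 1 (ucm i) m) (fsubset_refl _))).
rewrite [mderiv _ _ in RHS](mderivU e c (erefl << m >>) dm) -/d [in RHS](malgU_C c m).
under [X in _ * X = _]eq_bigr => j _ do rewrite cmM cmU.
exact: (@leibniz_sum _ d i _ _ _ _ (fun j => << ucm j >> ^+ (e - 1)) (fun j => m j)
  (exprp1 _ e0) di).
Qed.

Definition Yhalf (k l : nat) : V -> V := mderiv (2 ^ k + 2 ^ l).

Fact Yhalf_zmod k l : zmod_morphism (Yhalf k l).
Proof. by move=> p q; rewrite /Yhalf raddfB. Qed.
HB.instance Definition _ k l := GRing.isZmodMorphism.Build V V (Yhalf k l) (Yhalf_zmod k l).
Fact Y_op_zmod k l : zmod_morphism (Y_op k l).
Proof. by move=> p q; rewrite /Y_op raddfB. Qed.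
HB.instance Definition _ k l := GRing.isZmodMorphism.Build V V (Y_op k l) (Y_op_zmod k l).

Lemma mulr_sum_double (S : pzRingType) I (r : seq I) c (F : I -> S) n :
  c * (\sum_(i <- r) F i *+ (2 * n i)) = (c * (\sum_(i <- r) F i *+ n i)) *+ 2.
Proof.
rewrite -mulrnAr -sumrMnl; congr (_ * _); apply: eq_bigr => i _.
by rewrite mulnC mulrnA.
Qed.

Lemma Y_op_half k l p : Y_op k l p = Yhalf k l p *+ 2.
Proof.
rewrite /Y_op /Yhalf /mderiv !mmapE -sumrMnl; apply: eq_bigr => m _.
exact: mulr_sum_double.
Qed.

Lemma Yhalf1 k l : Yhalf k l 1 = 0.
Proof. by rewrite /Yhalf /mderiv mmapU mdom1 big_seq_fset0 mulr0. Qed.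

Lemma YhalfX k l i p :
  Yhalf k l (xvar i * p) = xvar i ^+ (2 ^ k + 2 ^ l) * p + xvar i * Yhalf k l p.
Proof. by apply: mderivX; rewrite addn_gt0 expn_gt0. Qed.

Lemma Y_opX k l i p :
  Y_op k l (xvar i * p)
  = (xvar i ^+ (2 ^ k) * xvar i ^+ (2 ^ l) * p) *+ 2 + xvar i * Y_op k l p.
Proof. by rewrite !Y_op_half YhalfX mulrnDl exprD mulrnAr. Qed.

Lemma Y_op1 k l : Y_op k l 1 = 0.
Proof. by rewrite Y_op_half Yhalf1 mul0rn. Qed.

Lemma eq2_raddf (U W : zmodType) (f : {additive U -> W}) p q : eq2 p q -> eq2 (f p) (f q).
Proof. by rewrite /eq2 -!raddfMn => ->. Qed.

Lemma Y_op_eq2 k l p q : eq2 p q -> Y_op k l p = Y_op k l q.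
Proof.
move=> pq; apply: (etrans (Y_op_half k l p)); apply: (etrans _ (esym (Y_op_half k l q))).
exact: (eq2_raddf (Yhalf k l) pq).
Qed.

Lemma Y_op_mul2 k l p : Y_op k l p *+ 2 = 0.
Proof. by rewrite Y_op_half -mulrnA V_mul4. Qed.

HB.instance Definition _ (f : D0) := GRing.isZmodMorphism.Build V V f (D0_additive f).

(** * Relations between the generators of D_0 *)

Definition D0_ev (p : V) (f : D0) : V := f p.
Arguments D0_ev : simpl never.
Fact D0_ev_zmod p : zmod_morphism (D0_ev p).
Proof. by move=> f g; rewrite /D0_ev [LHS]D0_addE /= sub0r. Qed.
HB.instance Definition _ p := GRing.isZmodMorphism.Build D0 V (D0_ev p) (D0_ev_zmod p).

Lemma D0_evM p (f g : D0) : D0_ev p (f * g) = D0_ev (D0_ev p g) f.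
Proof. by []. Qed.

Lemma D0_evP (f g : D0) : (forall p, D0_ev p f = D0_ev p g) -> f = g.
Proof. exact: D0_eq. Qed.

Lemma D0_mul4 (f : D0) : f *+ 4 = 0.
Proof. by apply: D0_evP => p; rewrite raddfMn raddf0 /= V_mul4. Qed.

Lemma D0_ev_SqD n p : D0_ev p (SqD n) = sq n 0 p.
Proof. exact: esym (sq0 n p). Qed.

Lemma sqB n d p : (d <= n)%N -> sq (n - d) 0 p = sq n d p.
Proof. by move=> dn; rewrite -(sqD _ d) subnK. Qed.

Lemma SqD0 : SqD 0 = 1.
Proof. by apply: D0_evP => p; apply: Sq_op0. Qed.

Lemma wordD_adem_pair a b k : wordD (adem_pair a b k) = SqD (a + b - k) * SqD k.
Proof.
rewrite /wordD /adem_pair; case: eqP => [->|_]; rewrite !big_cons big_nil mulr1 //.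
by rewrite SqD0 mulr1 subn0.
Qed.

(** For a < 2b the bound 2k <= a forces k < b, so the extra clause of [adem_coef] is never active
    and the indices beyond a/2 contribute zero. *)
Lemma adem_idx_sum (U : nmodType) (F : nat -> U) a b : (a < b.*2)%N ->
  \sum_(k <- adem_idx a b) F k = \sum_(k < a.+1) F k *+ adem_coef a b k.
Proof.
move=> ab; rewrite /adem_idx big_filter -[iota _ _]/(index_iota 0 (a./2).+1).
rewrite big_mkcond /= -(big_mkord xpredT (fun k => F k *+ adem_coef a b k)).
rewrite [RHS](big_cat_nat _ (n := (a./2).+1)) //=; last by lia.
rewrite [X in _ = _ + X]big_nat_cond [X in _ = _ + X]big1 ?addr0; last first.
  by move=> k kP; rewrite /adem_coef (_ : (_ <= a)%N = false) //; lia.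
rewrite big_nat [RHS]big_nat; apply: eq_bigr => k kP; rewrite /adem_coef.
have ka : (k.*2 <= a)%N by rewrite -geq_half_double -ltnS.
have -> : (b <= k)%N = false by apply/negbTE; rewrite -ltnNge -ltn_double (leq_ltn_trans ka).
by rewrite ka /=; case: odd.
Qed.

Lemma eq2_ademD a b : (0 < a < b.*2)%N -> eq2 (ademD a b) 0.
Proof.
case/andP=> a0 ab; apply: D0_evP => p; rewrite raddfMn mul0rn raddf0 /=.
rewrite raddfD raddf_sum /=.
under eq_bigr => k _ do rewrite wordD_adem_pair D0_evM.
rewrite adem_idx_sum //.
have abb : (a <= b.*2.+1)%N by lia.
apply: etrans (etrans (@adem_op_eq0 _ xvar sq V_mul4 Vind sq1 sqX sqD sq0S
  a.+1 a b p (leqnn _) abb) (mul0rn _ _)).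
rewrite /adem_op D0_evM !D0_ev_SqD; congr ((_ + _) *+ 2); apply: eq_bigr => k _.
have kab : (k <= a + b)%N by rewrite (leq_trans _ (leq_addr _ _)) // -ltnS.
by rewrite !D0_ev_SqD sqB.
Qed.

Lemma YD_eq2 k l (f g : D0) : eq2 f g -> YD k l * f = YD k l * g.
Proof.
move=> fg; apply: D0_evP => p; rewrite !D0_evM; apply: Y_op_eq2.
by rewrite /eq2 -!raddfMn /= fg.
Qed.

Lemma YD_mul2 k l : YD k l *+ 2 = 0.
Proof. by apply: D0_evP => p; rewrite raddfMn raddf0; apply: Y_op_mul2. Qed.

Definition SqD_minus (n d : nat) : D0 := if (d <= n)%N then SqD (n - d) else 0.

Lemma D0_ev_SqD_minus n d p : D0_ev p (SqD_minus n d) = sq n d p.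
Proof. by rewrite /SqD_minus /sq; case: ifP => // _; rewrite raddf0. Qed.

Lemma SqD_YD n k l :
  SqD n * YD k l = YD k l * SqD n + YD k.+1 l * SqD_minus n (2 ^ k)
    + YD k l.+1 * SqD_minus n (2 ^ l) + YD k.+1 l.+1 * SqD_minus n (2 ^ k + 2 ^ l).
Proof.
apply: D0_evP => p; rewrite !raddfD /= !D0_evM !D0_ev_SqD_minus.
have := @sq_Y _ xvar sq Y_op V_mul4 Vind sq1 sqX sq_xvar_pow Y_op1 Y_opX n 0 k l p.
by rewrite !add0n !D0_ev_SqD.
Qed.

Lemma YD00 : YD 0 0 = SqD 1 *+ 2.
Proof.
apply: D0_evP => p; rewrite raddfMn /=.
rewrite D0_ev_SqD; apply: (@Y00 _ xvar sq Y_op Vind sq1 sqX Y_op1 Y_opX) => q.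
exact: (etrans (sqB q (leqnn 1)) (Sq_op0 q)).
Qed.

(** In [SqD_YD] for Sq^(2^(n+1)) and k = l = n, the last factor is Sq^0 = 1, and the two middle
    terms coincide by symmetry of Y, so they cancel because 2 Y = 0. The result is the recursion
    that defines [milnorQ]. *)
Lemma YD_diagS n :
  YD n.+1 n.+1 = SqD (2 ^ n.+1) * YD n n + YD n n * SqD (2 ^ n.+1).
Proof.
have YM2 k l (f : D0) : YD k l * f *+ 2 = 0 by rewrite -mulrnAl YD_mul2 mul0r.
have Ysym k l : YD k l = YD l k.
  by apply: D0_eq => p /=; rewrite /Y_op (addnC (2 ^ k)%N).
rewrite SqD_YD /SqD_minus addnn -muln2 -expnSr leqnn subnn SqD0 mulr1.
rewrite (Ysym n n.+1) -(addrA (YD n n * _)) -mulr2n YM2 addr0 addrAC -mulr2n YM2.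
by rewrite add0r.
Qed.

(** * Lifting A to D_0 modulo 2 *)

Lemma malg_sum_zmod (K : choiceType) (G U : zmodType) (F : K -> {additive G -> U}) :
  zmod_morphism (fun x : {malg G[K]} => \sum_(k <- msupp x) F k x@_k).
Proof.
move=> x y.
have sumE (z : {malg G[K]}) (d : {fset K}) : (msupp z `<=` d)%fset ->
    \sum_(k <- msupp z) F k z@_k = \sum_(k <- d) F k z@_k.
  move=> zd; apply: big_fset_incl => // k _; rewrite -mcoeff_eq0 => /eqP->.
  by rewrite raddf0.
set d := (msupp x `|` msupp y)%fset.
rewrite (sumE (x - y) d (msuppB_le _ _)) (sumE x d (fsubsetUl _ _)).
rewrite (sumE y d (fsubsetUr _ _)) -sumrB; apply: eq_bigr => k _.
by rewrite mcoeffB raddfB.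
Qed.

(** Nonzero coefficients in F_2 are lifted to 1 in Z/4, so the lift is additive only up to [eq2]. *)
Definition free_lift (x : freeA) : D0 := \sum_(w <- msupp x) wordD w.

Lemma eq2Mr (S : pzRingType) (p q r : S) : eq2 p q -> eq2 (p * r) (q * r).
Proof. by rewrite /eq2 => pq; rewrite -mulrnAl pq mulrnAl. Qed.

(** F_2 acts on doubles because 4 = 0 in D_0; this makes twice the lift an additive function of the
    element of the free algebra. *)
Definition scale2 (f : D0) (c : 'F_2) : D0 := f *+ 2 *+ c.

Fact scale2_zmod (f : D0) : zmod_morphism (scale2 f).
Proof.
have f4 : f *+ 2 *+ 2 = 0 by rewrite -mulrnA D0_mul4.
by case=> [[|[|c]] // ic] [[|[|d]] // id]; rewrite /scale2 /= ?mulr0n ?mulr1n ?subr0 ?subrr //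
  sub0r; apply/eqP; rewrite -subr_eq0 opprK -mulr2n f4.
Qed.
HB.instance Definition _ f := GRing.isZmodMorphism.Build 'F_2 D0 (scale2 f) (scale2_zmod f).

Lemma free_lift2E (x : freeA) :
  free_lift x *+ 2 = \sum_(w <- msupp x) scale2 (wordD w) x@_w.
Proof.
rewrite /free_lift -sumrMnl big_seq [RHS]big_seq; apply: eq_bigr => w.
by rewrite -mcoeff_neq0 /scale2; case: (x@_w) => [[|[|c]] // ic] _; rewrite mulr1n.
Qed.

Lemma free_lift2B x y : free_lift (x - y) *+ 2 = free_lift x *+ 2 - free_lift y *+ 2.
Proof.
rewrite !free_lift2E.
exact: (malg_sum_zmod (fun w : {fmonom nat} => scale2 (wordD w))).
Qed.

Lemma free_lift_word w : free_lift (free_word w) = wordD w.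
Proof. by rewrite /free_lift msuppU oner_eq0 big_seq_fset1. Qed.

Lemma freeA_ind (P : freeA -> Prop) : P 0 ->
  (forall x y, P x -> P y -> P (x + y)) -> (forall w, P (free_word w)) -> forall x, P x.
Proof.
move=> P0 PD PW x; rewrite [x]monalgE; elim/big_ind: _ => [||[w] _]; [exact: P0|exact: PD|].
case: (x@__) => [[|[|c]] // ic].
  by rewrite (_ : Ordinal ic = 0) ?monalgU0 //; apply: val_inj.
by rewrite (_ : Ordinal ic = 1); [exact: PW|apply: val_inj].
Qed.

Lemma free_wordM v w : free_word v * free_word w = free_word (v ++ w).
Proof.
rewrite [LHS]malgU_mul mulr1; congr << _ >>.
exact: fmmulE.
Qed.

Lemma free_word_nil : free_word [::] = 1.
Proof. by apply: esym; congr << _ >>; apply: fmoneE. Qed.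

Lemma wordD_cat v w : wordD (v ++ w) = wordD v * wordD w.
Proof. by rewrite /wordD big_cat. Qed.

Lemma free_lift2D x y : eq2 (free_lift (x + y)) (free_lift x + free_lift y).
Proof.
have L0 : free_lift 0 = 0 by rewrite /free_lift msupp0 big_seq_fset0.
rewrite /eq2 mulrnDl -[y in LHS]opprK free_lift2B -[- y]sub0r free_lift2B L0 mul0rn.
by rewrite sub0r opprK.
Qed.

Lemma free_lift2M x y : eq2 (free_lift (x * y)) (free_lift x * free_lift y).
Proof.
have L0 : free_lift 0 = 0 by rewrite /free_lift msupp0 big_seq_fset0.
elim/freeA_ind: x => [|x x' hx hx'|v].
- by rewrite mul0r L0 mul0r.
- rewrite mulrDl; apply: etrans (free_lift2D _ _) _.
  apply: etrans (eq2D hx hx') _; rewrite -[free_lift x * _ + _]mulrDl.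
  exact: esym (eq2Mr _ (free_lift2D x x')).
elim/freeA_ind: y => [|y y' hy hy'|w].
- by rewrite mulr0 L0 mulr0.
- rewrite mulrDr; apply: etrans (free_lift2D _ _) _.
  apply: etrans (eq2D hy hy') _; rewrite -[_ * free_lift y + _]mulrDr.
  exact: esym (eq2Ml _ (free_lift2D y y')).
by rewrite free_wordM !free_lift_word wordD_cat.
Qed.

(** The operators satisfy the defining relations of A up to doubles, so the representative picked by
    [some_lift] matters only up to [eq2]. *)
Lemma adem_ideal_lift x : adem_ideal x -> eq2 (free_lift x) 0.
Proof.
elim=> {x} [|a b ab|x y _ hx _ hy|x y z _ hy].
- rewrite /eq2 free_lift2B free_lift_word.
  have -> : free_lift 1 = wordD [::] by rewrite -free_lift_word free_word_nil.
  by rewrite /wordD big_cons big_nil mulr1 SqD0 subrr mul0rn.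
- apply: etrans (eq2_ademD ab); apply: etrans (free_lift2D _ _) _.
  rewrite /ademD !mulrnDl; congr (_ + _).
    by rewrite free_lift_word /wordD !big_cons big_nil mulr1.
  elim: (adem_idx a b) => [|k s IH].
    by rewrite !big_nil /free_lift msupp0 big_seq_fset0.
  rewrite !big_cons; apply: etrans (free_lift2D _ _) _.
  rewrite !mulrnDl IH free_lift_word; congr (_ + _).
  by rewrite wordD_adem_pair /wordD !big_cons big_nil mulr1.
- by rewrite /eq2 free_lift2B hx hy mul0rn subr0.
apply: etrans (free_lift2M _ _) _; apply: etrans (eq2Mr _ (free_lift2M _ _)) _.
by apply: etrans (eq2Mr _ (eq2Ml _ hy)) _; rewrite mulr0 mul0r.
Qed.

Lemma some_lift_toA x : eq2 (some_lift (toA x)) (free_lift x).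
Proof.
have : adem_ideal (ofA (toA x) - x) by apply/toAP; rewrite ofAK.
move/adem_ideal_lift; rewrite /eq2 free_lift2B mul0rn => /eqP.
by rewrite subr_eq0 => /eqP.
Qed.

Lemma some_liftD a b : eq2 (some_lift (a + b)) (some_lift a + some_lift b).
Proof.
have -> : a + b = toA (ofA a + ofA b) by rewrite (raddfD toA) /= !ofAK.
exact: (etrans (some_lift_toA _) (free_lift2D (ofA a) (ofA b))).
Qed.

Lemma some_liftM a b : eq2 (some_lift (a * b)) (some_lift a * some_lift b).
Proof. exact: (etrans (some_lift_toA _) (free_lift2M (ofA a) (ofA b))). Qed.

Lemma wordA_toA w : wordA w = toA (free_word w).
Proof.
elim: w => [|n w IH]; rewrite /wordA ?big_nil ?big_cons.
  exact: (congr1 toA (esym free_word_nil)).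
by rewrite -/(wordA w) IH [LHS]toAM free_wordM.
Qed.

Lemma some_lift_word w : eq2 (some_lift (wordA w)) (wordD w).
Proof. by rewrite wordA_toA -free_lift_word; apply: some_lift_toA. Qed.

Lemma some_lift_Sq n : eq2 (some_lift (Sq n)) (SqD n).
Proof.
by have := some_lift_word [:: n]; rewrite /wordA /wordD !big_cons !big_nil !mulr1.
Qed.

Lemma some_lift0 : eq2 (some_lift 0) 0.
Proof.
have -> : 0 = toA 0 by rewrite raddf0.
by apply: etrans (some_lift_toA _) _; rewrite /free_lift msupp0 big_seq_fset0.
Qed.

Lemma steenrod_mul2 (a : steenrod) : a *+ 2 = 0.
Proof.
rewrite -(ofAK a) -raddfMn (_ : _ *+ 2 = 0) ?raddf0 //.
apply/malgP => k; rewrite mcoeffMn mcoeff0; move: (_@_k) => c.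
by apply: val_inj; case: c => [[|[|c]] ic].
Qed.

(** Makes the boundary agree with the convention U_(k,k) = mu_0 Q_k + (an element of the copy of A),
    whose boundary is 2 Q_k. *)
Lemma YD_milnorQ n : YD n n = some_lift (milnorQ n) *+ 2.
Proof.
elim: n => [|n IH]; first by rewrite YD00 /= [RHS]some_lift_Sq.
rewrite YD_diagS IH mulrnAr mulrnAl -mulrnDl; apply: esym; set q := milnorQ n.
set s := Sq (2 ^ n.+1).
have e1 := etrans (some_liftM s q) (eq2Mr (some_lift q) (some_lift_Sq (2 ^ n.+1))).
have e2 := etrans (some_liftM q s) (eq2Ml (some_lift q) (some_lift_Sq (2 ^ n.+1))).
exact: (etrans (some_liftD (s * q) (q * s)) (eq2D e1 e2)).
Qed.

(** * The boundary D_1 -> D_0 *)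

Lemma bd_gen_eq2 g (f h : D0) : eq2 f h -> bd_gen g * f = bd_gen g * h.
Proof.
case: g => [[[[k l] kl]|]|] fh /=; first exact: YD_eq2; last by rewrite !mul0r.
by rewrite !mulr_natl.
Qed.

Definition bd_coef (g : D1_gen) (a : steenrod) : D0 := bd_gen g * some_lift a.

Fact bd_coef_zmod g : zmod_morphism (bd_coef g).
Proof.
have D a b : bd_coef g (a + b) = bd_coef g a + bd_coef g b.
  by rewrite /bd_coef -mulrDr; apply: bd_gen_eq2; apply: some_liftD.
move=> a b; apply/eqP; rewrite eq_sym subr_eq -D.
by rewrite subrK.
Qed.
HB.instance Definition _ g := GRing.isZmodMorphism.Build steenrod D0 (bd_coef g)
  (bd_coef_zmod g).

Fact bd_zmod : zmod_morphism bd.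
Proof. exact: (malg_sum_zmod bd_coef). Qed.
HB.instance Definition _ := GRing.isZmodMorphism.Build D1 D0 bd bd_zmod.

Lemma bdU g a : bd << a *g g >> = bd_gen g * some_lift a.
Proof.
rewrite /bd msuppU; case: eqP => [->|_]; last by rewrite big_seq_fset1 mcoeffUU.
by rewrite big_seq_fset0; exact: esym (raddf0 (bd_coef g)).
Qed.

Lemma bd_mu0 a : bd (mu0 a) = some_lift a *+ 2.
Proof. by rewrite bdU /= mulr_natl. Qed.

Lemma bd_inA a : bd (inA a) = 0.
Proof. by rewrite bdU mul0r. Qed.

Lemma bd_mu0_inA a b : bd (mu0 a + inA b) = some_lift a *+ 2.
Proof.
apply: etrans (raddfD bd _ _) _; apply: etrans (congr2 +%R (bd_mu0 a) (bd_inA b)) _.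
by rewrite addr0.
Qed.

Lemma bd_U k l a : (k <= l)%N -> bd (U k l a) = YD k l * some_lift a.
Proof.
move=> kl; rewrite /U; case: insubP => [[p pP] _ /= ep|].
  by rewrite bdU /= ep.
rewrite -leqNgt /= => lk; have -> : l = k by apply/eqP; rewrite eqn_leq kl lk.
rewrite bd_mu0_inA YD_milnorQ mulrnAl.
exact: (some_liftM (milnorQ k) a).
Qed.

Lemma some_lift_Sq_minus n d : eq2 (some_lift (Sq_minus n d)) (SqD_minus n d).
Proof.
rewrite /Sq_minus /SqD_minus; case: ifP => _; [exact: some_lift_Sq|exact: some_lift0].
Qed.

(** The contraction term of Sq^n mu_0 lands in the copy of A, where the boundary is 0. The four
    terms of Sq^n U_(k,l) match [SqD_YD]; since k < l, raising either index by one keeps the pair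
    weakly increasing, as [bd_U] requires. *)
Lemma bd_Sq_act n x : bd (Sq_act n x) = SqD n * bd x.
Proof.
rewrite {2}/bd mulr_sumr /Sq_act raddf_sum; apply: eq_bigr => g _ /=.
move: (x@_g) => a; rewrite mulrA; case: g => [[[[k l] kl]|]|] /=; last first.
- by rewrite bd_inA mulr0 mul0r.
- rewrite bd_mu0_inA mulr_natr mulrnAl.
  exact: (etrans (some_liftM (Sq n) a) (eq2Mr (some_lift a) (some_lift_Sq n))).
have kl' : (k < l)%N := kl.
have D4 (x1 x2 x3 x4 : D1) y1 y2 y3 y4 : bd x1 = y1 -> bd x2 = y2 -> bd x3 = y3 ->
    bd x4 = y4 -> bd (x1 + x2 + x3 + x4) = y1 + y2 + y3 + y4.
  by move=> <- <- <- <-; rewrite 3!(raddfD bd).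
apply: etrans (D4 _ _ _ _ _ _ _ _ (bd_U _ (ltnW kl')) (bd_U _ kl')
  (bd_U _ (leqW (ltnW kl'))) (bd_U _ (leqW kl'))) _.
have YM i j d b : YD i j * some_lift (Sq_minus n d * b)
    = YD i j * SqD_minus n d * some_lift b.
  rewrite -mulrA; apply: YD_eq2; 
  exact: (etrans (some_liftM (Sq_minus n d) b) (eq2Mr (some_lift b) (some_lift_Sq_minus n d))).
have -> : Sq n = Sq_minus n 0 by rewrite /Sq_minus subn0.
by rewrite !YM -!mulrDl SqD_YD /SqD_minus leq0n subn0.
Qed.

Lemma bd_word_act al x : bd (word_act al x) = wordD al * bd x.
Proof.
elim: al => [|n al IH]; first by rewrite /wordD big_nil mul1r.
by rewrite /= bd_Sq_act IH mulrA /wordD big_cons.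
Qed.

Lemma bd_act_word x be : bd (act_word x be) = bd x * wordD be.
Proof.
rewrite {2}/bd mulr_suml /act_word raddf_sum; apply: eq_bigr => g _ /=.
rewrite bdU -mulrA; apply: bd_gen_eq2.
exact: (etrans (some_liftM x@_g (wordA be)) (eq2Ml (some_lift x@_g) (some_lift_word be))).
Qed.

(** * Independence of the admissible words *)

(** Renumbering the variables frees x_0, so that x_0 [shiftV u] contains x_0 exactly once in each
    monomial. *)
Definition shiftV : {rmorphism V -> V} :=
  Veval (@malgC {cmonom nat} 'Z_4) (fun i => xvar i.+1).

(** V read as polynomials in x_0 whose coefficients, in the other variables, are renumbered back
    into V. *)
Definition splitV : {rmorphism V -> {poly V}} :=
  Veval (polyC \o @malgC {cmonom nat} 'Z_4)
    (fun i => if i is j.+1 then (xvar j)%:P else 'X).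

Lemma Vmorph_comp (S S' T : comNzRingType) (f : {rmorphism S -> T})
    (h : {rmorphism V -> S}) (f' : {rmorphism S' -> T}) (h' : {rmorphism V -> S'}) :
  (forall i, f (h (xvar i)) = f' (h' (xvar i))) -> forall p, f (h p) = f' (h' p).
Proof. by move=> e p; exact: (Vmorph_eq (f := f \o h) (g := f' \o h') e p). Qed.

Lemma shiftV_xvar i : shiftV (xvar i) = xvar i.+1.
Proof. exact: Veval_xvar. Qed.

Lemma splitV_xvarS i : splitV (xvar i.+1) = (xvar i)%:P.
Proof. exact: Veval_xvar. Qed.

Lemma splitV_shift p : splitV (shiftV p) = p%:P.
Proof.
apply: (@Vmorph_comp _ _ _ splitV shiftV polyC idfun) => i.
by rewrite shiftV_xvar splitV_xvarS.
Qed.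

Lemma splitV_x0 : splitV (xvar 0) = 'X.
Proof. exact: Veval_xvar. Qed.

Lemma total_sq_shift p : total_sq (shiftV p) = map_poly shiftV (total_sq p).
Proof.
apply: (@Vmorph_comp _ _ _ total_sq shiftV (map_poly shiftV) total_sq) => i.
rewrite shiftV_xvar [RHS](congr1 (map_poly shiftV) (total_sq_xvar i)) [LHS]total_sq_xvar.
by rewrite rmorphD /= map_polyC /= map_polyZ /= map_polyX rmorphXn /= shiftV_xvar.
Qed.

Lemma coefXnM_map (S : nzRingType) (f : {rmorphism S -> S}) (P : {poly S}) n d :
  ('X^d * map_poly f P)`_n = f ('X^d * P)`_n.
Proof. by rewrite !coefXnM; case: ifP => _; rewrite ?rmorph0 ?coef_map. Qed.

Lemma sq_shift n d p : sq n d (shiftV p) = shiftV (sq n d p).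
Proof.
apply: (etrans (sqE n d (shiftV p))); apply: (etrans _ (esym (congr1 shiftV (sqE n d p)))).
apply: (etrans (congr1 (fun P : {poly V} => ('X^d * P)`_n) (total_sq_shift p))).
exact: coefXnM_map.
Qed.

Definition coef_x0 (e : nat) (p : V) : V := (splitV p)`_e.
Fact coef_x0_zmod e : zmod_morphism (coef_x0 e).
Proof. by move=> p q; rewrite /coef_x0 rmorphB coefB. Qed.
HB.instance Definition _ e := GRing.isZmodMorphism.Build V V (coef_x0 e) (coef_x0_zmod e).

Lemma coef_x0E e k p : coef_x0 e (xvar 0 ^+ k * shiftV p) = p *+ (k == e).
Proof.
rewrite /coef_x0 rmorphM rmorphXn /= splitV_shift splitV_x0 mulrC coefCM coefXn.
by rewrite mulr_natr eq_sym.
Qed.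

(* Sq^(a_1 - 2^(r-1)) ... Sq^(a_r - 1) u, the coefficient of x_0^(2^r) in
   Sq^(a_1) ... Sq^(a_r) (x_0 u). *)
Fixpoint lead (w : word) (u : V) : V :=
  if w is a :: w' then sq a (2 ^ size w') (lead w' u) else u.

Section LeadingCoefficient.

Variables (W : comNzRingType) (sq : nat -> nat -> {additive W -> W}) (y : W).
Variable sh : {additive W -> W}.
Hypothesis sq_sh : forall n d k p,
  eq2 (sq n d (y ^+ (2 ^ k) * sh p))
    (y ^+ (2 ^ k) * sh (sq n d p) + y ^+ (2 ^ k.+1) * sh (sq n (d + 2 ^ k) p)).

Let act (w : word) (p : W) : W := foldr (fun a => sq a 0%N) p w.

Fixpoint lead_gen (w : word) (u : W) : W :=
  if w is a :: w' then sq a (2 ^ size w') (lead_gen w' u) else u.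

(** Each letter either keeps a power y^(2^i) or raises it to y^(2^(i+1)). After r letters the
    exponent is at most 2^r, and it is reached only when every letter raises it. *)
Lemma act_lead w u : exists G : nat -> W,
  [/\ G (size w) = lead_gen w u, forall i, (size w < i)%N -> G i = 0 &
      eq2 (act w (y * sh u)) (\sum_(i < (size w).+1) y ^+ (2 ^ i) * sh (G i))].
Proof.
elim: w => [|a w [G [Gt G0 GE]]].
  exists (fun i => if i is 0%N then u else 0); split=> //; first by case.
  by rewrite /act /= big_ord_recl big_ord0 addr0 expr1.
(* The power y^(2^i) comes from y^(2^i) kept by the new letter, or from y^(2^(i-1)) raised by it. *)
exists (fun i => sq a 0 (G i) + (if i is j.+1 then sq a (2 ^ j) (G j) else 0)); split.
- by rewrite /= G0 // raddf0 add0r Gt.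
- by case=> // i /= wi; rewrite !G0 ?raddf0 ?addr0 // ltnW.
apply: etrans (eq2_raddf (sq a 0) GE) _; rewrite raddf_sum.
apply: etrans (eq2_sum _ (fun i : 'I_(size w).+1 => sq_sh a 0 i (G i))) _.
congr (_ *+ 2); under [RHS]eq_bigr => i _ do rewrite raddfD mulrDr.
rewrite !big_split /=; congr (_ + _).
  by rewrite [RHS]big_ord_recr /= G0 // raddf0 raddf0 mulr0 addr0.
by rewrite [RHS]big_ord_recl /= raddf0 mulr0 add0r.
Qed.

End LeadingCoefficient.

Lemma wordD_ev w p : D0_ev p (wordD w) = foldr (fun a => sq a 0) p w.
Proof.
elim: w => [|a w IH] /=; first by rewrite /wordD big_nil.
by rewrite /wordD big_cons D0_evM D0_ev_SqD; congr (sq _ _ _).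
Qed.

Lemma coef_x0_word w u :
  eq2 (coef_x0 (2 ^ size w) (D0_ev (xvar 0 * shiftV u) (wordD w))) (lead w u).
Proof.
have sqsh n d k p : eq2 (sq n d (xvar 0 ^+ (2 ^ k) * shiftV p))
    (xvar 0 ^+ (2 ^ k) * shiftV (sq n d p)
     + xvar 0 ^+ (2 ^ k.+1) * shiftV (sq n (d + 2 ^ k) p)).
  rewrite -(sq_shift n d) -(sq_shift n (d + 2 ^ k)).
  exact: sq_xvar_pow.
have [G [Gt G0 GE]] := @act_lead _ sq (xvar 0) shiftV sqsh w u.
rewrite wordD_ev; apply: etrans (eq2_raddf (coef_x0 (2 ^ size w)) GE) _.
congr (_ *+ 2); rewrite raddf_sum big_ord_recr big1 /= => [|i _].
  by rewrite add0r coef_x0E eqxx mulr1n Gt.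
by rewrite coef_x0E eqn_exp2l // ltn_eqF.
Qed.

(** Unlike in [admissible], trailing zero letters are allowed, so that words can be padded to a
    common length. *)
Notation halving := (sorted [rel a b | (b.*2 <= a)%N]).

(** The last letter is lowered by 2^0 = 1, and Sq^(0-1) is zero. *)
Lemma lead0 w u : w != [::] -> last 0%N w = 0%N -> lead w u = 0.
Proof.
elim: w => // a [|b w] IH _ wl; first by rewrite /= in wl *; rewrite wl; apply: sq0S.
exact: (etrans (congr1 (sq a _) (IH isT wl)) (raddf0 _)).
Qed.

Fixpoint lower (w : word) : word :=
  if w is a :: w' then (a - 2 ^ size w')%N :: lower w' else [::].

Lemma size_lower w : size (lower w) = size w.
Proof. by elim: w => //= a w ->. Qed.

Lemma halving_ge a w : halving (a :: w) -> (0 < last a w)%N -> (2 ^ size w <= a)%N.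
Proof.
elim: w a => [|b w IH] a //= /andP[ba bw] wl.
by have := IH b bw wl; rewrite expnS; lia.
Qed.

Lemma lead_lower w u : halving w -> (0 < last 0 w)%N -> lead w u = D0_ev u (wordD (lower w)).
Proof.
elim: w => // a w IH aw wl; rewrite /= {1}/wordD big_cons -/(wordD _) D0_evM D0_ev_SqD.
have aw2 : (2 ^ size w <= a)%N by apply: halving_ge.
apply: (etrans _ (esym (sqB _ aw2))); apply: (congr1 (sq a (2 ^ size w))).
case: w IH aw wl aw2 => [|b w] IH aw wl aw2; first by rewrite /wordD big_nil.
by case/andP: aw => _ bw; exact: IH bw wl.
Qed.

Lemma halving_lower w : halving w -> (0 < last 0 w)%N -> halving (lower w).
Proof.
elim: w => // a [|b w] IH //= /andP[ba bw] wl.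
rewrite -[path _ _ _]/(halving (lower (b :: w))) (IH bw wl) andbT expnS; lia.
Qed.

Lemma sumn_lower w : halving w -> (0 < last 0 w)%N -> (sumn (lower w) < sumn w)%N.
Proof.
elim: w => // a w IH aw wl /=.
have aw2 : (2 ^ size w <= a)%N by apply: halving_ge.
have : (0 < 2 ^ size w)%N by rewrite expn_gt0.
suff : (sumn (lower w) <= sumn w)%N by lia.
case: w IH aw wl {aw2} => [|b w] IH // /andP[_ bw] wl; exact: ltnW (IH bw wl).
Qed.

(** By [halving_ge] none of the subtractions in [lower] is truncated. *)
Lemma lower_inj v w : size v = size w -> halving v -> halving w ->
  (0 < last 0 v)%N -> (0 < last 0 w)%N -> lower v = lower w -> v = w.
Proof.
elim: v w => [|a v IH] [|b w] // [svw] av bw vl wl [ab vw].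
have := halving_ge av vl; have := halving_ge bw wl; rewrite svw in ab * => hb ha.
have -> : a = b by lia.
congr (_ :: _); case: v w svw av bw vl wl vw IH {ab ha hb} => [|a' v] [|b' w] //= svw.
move=> /andP[_ av] /andP[_ bw] vl wl vw IH; exact: (IH (b' :: w)).
Qed.

Lemma eq2_one_neq0 : ~ eq2 (1 : V) 0.
Proof.
rewrite /eq2 mul0rn => /(congr1 (mcoeff (mone : {cmonom nat}))).
by rewrite mcoeffMn mcoeff0 mcoeff1 eqxx => /eqP.
Qed.

Lemma eq2_coef_x0_sum (X : seq word) h : all (fun w => size w == h) X ->
  eq2 (\sum_(w <- X) wordD w) 0 -> forall u, eq2 (\sum_(w <- X) lead w u) 0.
Proof.
move=> Xh X0 u.
have := eq2_raddf (coef_x0 (2 ^ h)) (eq2_raddf (D0_ev (xvar 0 * shiftV u)) X0).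
rewrite !raddf0 !raddf_sum /= => {X0} X0; apply: etrans X0; apply: esym.
elim: X Xh => [|w X IH] /=; first by rewrite !big_nil.
case/andP=> /eqP wh Xh; rewrite !big_cons; apply: eq2D (IH Xh).
by rewrite -wh; apply: coef_x0_word.
Qed.

(* The coefficient of x_0^(2^h) in the sum applied to x_0 u sees only the words whose
   last letter is nonzero and lowers their degree, so by induction there are none; a
   last letter 0 can be dropped. *)
Lemma halving_free h (X : seq word) : uniq X ->
  all (fun w => (size w == h) && halving w) X ->
  eq2 (\sum_(w <- X) wordD w) 0 -> X = [::].
Proof.
elim: h X => [|h IHh] X.
  case: X => [|v [|w X]] //; rewrite /= ?andbT.
    move=> _ /andP[/nilP-> _] /(eq2_raddf (D0_ev 1)).
    by rewrite raddf0 big_seq1 /wordD big_nil => /eq2_one_neq0.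
  by rewrite inE negb_or => /andP[/andP[vw _] _] /and3P[/andP[/nilP ev _] /andP[/nilP ew _] _];
    rewrite ev ew eqxx in vw.
(* A strict bound on the degrees; the inner induction is on this bound, the outer one on the
   length. *)
pose n := (\max_(w <- X) sumn w).+1.
have : all (fun w => sumn w < n)%N X.
  by apply/allP => w wX; rewrite ltnS; exact: leq_bigmax_seq.
move: n => n; elim: n X => [|n IHn] X Xn uX hX X0; first by case: X Xn {uX hX X0}.
have hXP w : w \in X -> size w = h.+1 /\ halving w.
  by move=> /(allP hX)/andP[/eqP].
pose X1 := [seq w <- X | (0 < last 0 w)%N].
have X1P w : w \in X1 -> [/\ w \in X, size w = h.+1, halving w & (0 < last 0 w)%N].
  by rewrite mem_filter => /andP[wl wX]; have [] := hXP w wX.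
have X1nil : X1 = [::].
  suff : [seq lower w | w <- X1] = [::] by case: X1 {X1P}.
  apply: IHn.
  - apply/allP => _ /mapP[w /X1P[wX _ hw lw] ->].
    by rewrite (leq_trans (sumn_lower hw lw)) // -ltnS (allP Xn w wX).
  - rewrite map_inj_in_uniq ?filter_uniq // => v w /X1P[_ sv hv lv] /X1P[_ sw hw lw].
    by apply: lower_inj => //; rewrite sv sw.
  - apply/allP => _ /mapP[w /X1P[_ sw hw lw] ->].
    by rewrite size_lower sw eqxx halving_lower.
  apply: D0_evP => u; have Xh : all (fun w => size w == h.+1) X.
    by apply/allP => w /hXP[-> _].
  rewrite raddfMn mul0rn raddf0 -[RHS](mul0rn _ 2) -[RHS](eq2_coef_x0_sum Xh X0 u).
  congr (_ *+ 2); rewrite big_map raddf_sum big_filter big_mkcond big_seq [RHS]big_seq.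
  apply: eq_bigr => w wX; have [sw hw] := hXP w wX.
  case: (posnP (last 0 w)) => lw; last by rewrite lead_lower.
  by rewrite lead0 //; case: w sw {wX hw lw}.
have lX w : w \in X -> last 0 w = 0%N.
  move=> wX; case: (posnP (last 0 w)) => // lw.
  by have : w \in X1; [rewrite mem_filter lw|rewrite X1nil].
have Xtake w : w \in X -> w = rcons (take h w) 0%N.
  move=> wX; have [sw _] := hXP w wX; case/lastP: w sw wX => // w a.
  rewrite size_rcons => -[sw] /lX; rewrite last_rcons => ->.
  by rewrite -sw -[in take _ _]cats1 take_size_cat.
suff : [seq take h w | w <- X] = [::] by case: X {Xn uX hX X0 hXP X1 X1P X1nil lX Xtake}.
apply: IHh.
- by rewrite map_inj_in_uniq // => v w /Xtake ev /Xtake ew vw; rewrite ev vw -ew.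
- apply/allP => _ /mapP[w wX ->]; have [sw hw] := hXP w wX.
  by rewrite size_takel ?sw // eqxx take_sorted.
apply: etrans X0; congr (_ *+ 2); rewrite big_map big_seq [RHS]big_seq.
apply: eq_bigr => w wX; rewrite [in RHS](Xtake w wX) -cats1 wordD_cat.
by rewrite [wordD [:: _]]/wordD big_seq1 SqD0 mulr1.
Qed.

Definition pad (N : nat) (w : word) : word := w ++ nseq (N - size w) 0%N.

Lemma halving_pad N w : halving w -> halving (pad N w).
Proof.
rewrite /pad; move: (N - size w)%N => n hw; case: w hw => [|a w] hw.
  by case: n => //= n; elim: n.
rewrite /= in hw *; rewrite cat_path hw /=.
by elim: n (last a w) => //= n IH b; rewrite IH.
Qed.

Lemma pad_filter N w : 0%N \notin w -> [seq a <- pad N w | a != 0%N] = w.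
Proof.
move=> w0; rewrite filter_cat (_ : filter _ (nseq _ _) = [::]) ?cats0.
  by apply/all_filterP/allP => a aw; apply: contraNneq w0 => <-.
by elim: (N - size w)%N.
Qed.

Lemma wordD_pad N w : wordD (pad N w) = wordD w.
Proof.
rewrite wordD_cat (_ : wordD (nseq _ _) = 1) ?mulr1 // /wordD.
by elim: (N - size w)%N => [|n IH]; rewrite ?big_nil //= big_cons IH SqD0 mulr1.
Qed.

(** Padding with Sq^0 = 1 gives all words the common length that [halving_free] requires; deleting
    zeros recovers a word, as admissible words contain none. *)
Lemma admissible_freeD (X : fsum) : uniq X -> all admissible X -> eq2 (sumD X) 0 -> X = [::].
Proof.
move=> uX aX X0; pose N := \max_(w <- X) size w.
have aXP w : w \in X -> 0%N \notin w /\ halving w by move=> /(allP aX)/andP[].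
suff /eqP : [seq pad N w | w <- X] = [::] by rewrite -size_eq0 size_map size_eq0 => /eqP.
apply: (@halving_free N).
- rewrite map_inj_in_uniq // => v w /aXP[v0 _] /aXP[w0 _] vw.
  by rewrite -(pad_filter N v0) vw pad_filter.
- apply/allP => _ /mapP[w wX ->]; have [_ hw] := aXP w wX.
  rewrite halving_pad // andbT size_cat size_nseq subnKC //.
  exact: leq_bigmax_seq.
by rewrite big_map; under eq_bigr => w _ do rewrite wordD_pad.
Qed.

Lemma some_lift_sum (X : fsum) : eq2 (some_lift (sumA X)) (sumD X).
Proof.
elim: X => [|w X IH]; rewrite /sumA /sumD ?big_nil ?big_cons; first exact: some_lift0.
exact: (etrans (some_liftD (wordA w) (sumA X)) (eq2D (some_lift_word w) IH)).
Qed.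

Lemma count_mem_mod2 (X : fsum) w : count_mem w (mod2 X) = odd (count_mem w X).
Proof.
rewrite count_uniq_mem ?filter_uniq ?undup_uniq // mem_filter mem_undup.
case: (boolP (w \in X)) => [|wX]; first by rewrite andbT.
by rewrite (count_memPn wX).
Qed.

Lemma sum_mod2 (U : zmodType) (F : word -> U) (X : fsum) :
  (forall w, F w *+ 2 = 0) -> \sum_(w <- X) F w = \sum_(w <- mod2 X) F w.
Proof.
move=> F2; rewrite -big_undup_iterop_count /= big_filter big_mkcond [RHS]big_mkcond /=.
apply: eq_bigr => w _; rewrite Monoid.iteropE /=.
rewrite -[count_mem w X]odd_double_half; move: (_./2) => n.
have -> : iter (odd (count_mem w X) + n.*2) (+%R (F w)) 0 = F w *+ (odd (count_mem w X) + n.*2).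
  by elim: (_ + _)%N => [|k IH] //=; rewrite IH mulrS.
rewrite oddD odd_double addbF oddb mulrnDr -mul2n mulrnA F2 mul0rn addr0.
by case: odd.
Qed.

Lemma admissible_free (X : fsum) : all admissible X -> sumA X = 0 ->
  forall w, ~~ odd (count_mem w X).
Proof.
move=> aX X0 w; suff m2 : mod2 X = [::].
  by have := count_mem_mod2 X w; rewrite m2; case: odd.
apply: admissible_freeD; first by rewrite filter_uniq ?undup_uniq.
  by apply/allP => v; rewrite mem_filter mem_undup => /andP[_ /(allP aX)].
apply: etrans (esym (some_lift_sum _)) _.
rewrite /sumA -sum_mod2 -/(sumA X); last by move=> v; apply: steenrod_mul2.
rewrite X0; exact: some_lift0.
Qed.

(** * Tracked Adem reduction *)

Lemma admissible_rcons2 al a b :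
  admissible (rcons (rcons al a) b) = [&& admissible (rcons al a), b != 0%N & (b.*2 <= a)%N].
Proof.
rewrite /admissible mem_rcons inE negb_or [0%N == b]eq_sym.
have -> : halving (rcons (rcons al a) b) = halving (rcons al a) && (b.*2 <= a)%N.
  by case: al => [|c al] /=; rewrite ?andbT // rcons_path last_rcons.
by case: (b == 0%N); rewrite ?andbF //= -andbA.
Qed.

Lemma admissible_catl v w : admissible (v ++ w) -> admissible v.
Proof.
case/andP; rewrite mem_cat negb_or => /andP[v0 _] vw; rewrite /admissible v0 /=.
by rewrite -(take_size_cat (n := size v) w erefl) take_sorted.
Qed.

Lemma inadmissible_step al a b be : (0 < a < b.*2)%N -> ~~ admissible (al ++ [:: a, b & be]).
Proof.
case/andP=> _ ab; apply: contraL ab => w_adm; rewrite -leqNgt.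
have : admissible (rcons (rcons al a) b).
  by apply: (@admissible_catl _ be); rewrite -!cats1 -!catA.
by rewrite admissible_rcons2 => /and3P[].
Qed.

Lemma inadmissibleP w : 0%N \notin w -> ~~ admissible w -> exists al a b be,
  [/\ w = al ++ [:: a, b & be], (0 < a < b.*2)%N & admissible (rcons al a)].
Proof.
elim/last_ind: w => [|w c IH] //; rewrite mem_rcons inE negb_or => /andP[c0 w0] w_nadm.
have [w_adm|w_nadm'] := boolP (admissible w); last first.
  have [al [a [b [be [-> ab al_adm]]]]] := IH w0 w_nadm'.
  by exists al, a, b, (rcons be c); split=> //; rewrite -!cats1 -!catA.
case/lastP: w w0 w_adm w_nadm {IH} => [|al a] w0 w_adm.
  by rewrite /admissible /= inE c0.
rewrite admissible_rcons2 w_adm eq_sym c0 /= -ltnNge => ac.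
exists al, a, c, [::]; split=> //; first by rewrite -!cats1 -catA.
by rewrite ac andbT lt0n; apply: contraNneq w0 => <-; rewrite mem_rcons inE eqxx.
Qed.

(** If [al'] were longer than [al], the inadmissible pair a, b would lie inside the admissible
    prefix [rcons al' a']. *)
Lemma leftmost_step_leq al a b be al' a' b' be' :
  al ++ [:: a, b & be] = al' ++ [:: a', b' & be'] -> (0 < a < b.*2)%N ->
  admissible (rcons al' a') -> (size al' <= size al)%N.
Proof.
move=> e ab al'_adm; rewrite leqNgt; apply: contraL al'_adm => ss.
have -> : rcons al' a' = take (size al').+1 (al ++ [:: a, b & be]).
  by rewrite e -[al' ++ _]/(al' ++ [:: a'] ++ _) catA cats1 take_size_cat // size_rcons.
rewrite take_cat ltnNge ltnW ?ltnS 1?ltnW //=.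
have [n ->] : exists n, ((size al').+1 - size al = n.+2)%N.
  by exists ((size al').+1 - size al).-2; lia.
exact: inadmissible_step.
Qed.

Lemma leftmost_step_uniq al a b be al' a' b' be' :
  al ++ [:: a, b & be] = al' ++ [:: a', b' & be'] ->
  (0 < a < b.*2)%N -> admissible (rcons al a) ->
  (0 < a' < b'.*2)%N -> admissible (rcons al' a') ->
  [/\ al = al', a = a', b = b' & be = be'].
Proof.
move=> e ab ad ab' ad'; have /eqP ss : size al == size al'.
  by rewrite eqn_leq (leftmost_step_leq e) // (leftmost_step_leq (esym e)).
by move/eqP: e; rewrite eqseq_cat // => /andP[/eqP-> /eqP[]].
Qed.

(** Each letter is counted once for every letter to its left: the sum of i a_i, with positions i
    starting at 0. *)
Fixpoint moment (w : word) : nat := if w is _ :: w' then sumn w' + moment w' else 0.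

(* Termination: the degree is unchanged and letters move to the left. *)
Lemma moment_step al a b be k : (0 < a < b.*2)%N -> k \in adem_idx a b ->
  (moment (al ++ adem_pair a b k ++ be) < moment (al ++ [:: a, b & be]))%N.
Proof.
move=> ab; rewrite mem_filter mem_iota => /andP[_ ka].
have kb : (k < b)%N by have := half_leq (ltnW ka); lia.
have catE (v w : word) : moment (v ++ w) = (moment v + size v * sumn w + moment w)%N.
  by elim: v => //= x v IH; rewrite IH sumn_cat mulSn; lia.
have eqs : sumn (adem_pair a b k ++ be) = sumn [:: a, b & be].
  rewrite sumn_cat /adem_pair; case: eqP => _ /=; lia.
rewrite !catE eqs ltn_add2l /adem_pair.
by case: eqP => _ /=; lia.
Qed.

Lemma adem_pair_neq0 a b k : (0 < a < b.*2)%N -> k \in adem_idx a b ->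
  0%N \notin adem_pair a b k.
Proof.
move=> ab; rewrite mem_filter mem_iota => /andP[_ ka].
rewrite /adem_pair; case: eqP => k0; rewrite !inE; first by lia.
have := half_leq (ltnW ka); lia.
Qed.

Lemma sumn_adem_pair a b k : (a < b.*2)%N -> k \in adem_idx a b ->
  sumn (adem_pair a b k) = (a + b)%N.
Proof.
move=> ab; rewrite mem_filter mem_iota => /andP[_ ka].
rewrite /adem_pair; case: eqP => k0 /=; first by lia.
have := half_leq (ltnW ka); lia.
Qed.

(** In [reduces_bd], a is an intermediate word, b the boundary of its track, c its corrections and d
    its normal form. The word occurs once in the relation creating it, twice through its own
    correction and once through the induction hypothesis: four times in all. *)
Lemma cancel_pair (G : zmodType) (a b c d : G) :
  a *+ 4 = 0 -> b + c = a + d -> a + (b + (a *+ 2 + c)) = d.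
Proof.
move=> a4 e; have a4' : a + a + a + a = 0 by rewrite -a4 (mulrnDr a 2 2) mulr2n !addrA.
by rewrite mulr2n (addrCA b) e !addrA a4' add0r.
Qed.

Section Reduction.
Variable u : nat -> nat -> D1.

Lemma reduces_admE w o : reduces u w o -> admissible w -> o = Outcome [:: w] 0 [::].
Proof. by case=> // al a b be r wk ab al_adm _ /(negP (inadmissible_step _ _ ab)). Qed.

Lemma reduces_fun w o o' : reduces u w o -> reduces u w o' -> o = o'.
Proof.
move=> wo; elim: wo o' => {w o} [w w_adm|al a b be r wk ab al_adm _ IH] o' wo'.
  by rewrite (reduces_admE wo' w_adm).
move ew : (al ++ [:: a, b & be]) wo' => w wo'.
case: wo' ew => {w o'} [w w_adm ew|al' a' b' be' r' wk' ab' al_adm' rr' ew].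
  by move: w_adm; rewrite -ew (negbTE (inadmissible_step _ _ ab)).
have [eal ea eb ebe] := leftmost_step_uniq ew ab al_adm ab' al_adm'; subst al' a' b' be'.
have rE k : k \in adem_idx a b -> r k = r' k by move=> kI; apply: IH => //; apply: rr'.
congr Outcome.
- by congr flatten; apply/eq_in_map => k kI; rewrite rE.
- by congr (_ + _); apply: eq_big_seq => k kI; rewrite rE.
- by congr flatten; apply/eq_in_map => k kI; rewrite rE.
Qed.

Lemma reduces_ex w : 0%N \notin w -> exists o, reduces u w o.
Proof.
have [n] := ubnP (moment w); elim: n w => // n IH w wn w0.
have [w_adm|w_nadm] := boolP (admissible w).
  by exists (Outcome [:: w] 0 [::]); apply: reduces_adm.
have [al [a [b [be [ew ab al_adm]]]]] := inadmissibleP w0 w_nadm.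
pose wk k := al ++ adem_pair a b k ++ be.
have : forall k, exists o, k \in adem_idx a b -> reduces u (wk k) o.
  move=> k; have [kI|] := boolP (k \in adem_idx a b); last first.
    (* A default outcome off [adem_idx], so that [choice] yields a function on all of nat. *)
    by move=> _; exists (Outcome [::] 0 [::]).
  have [||o wo] := IH (wk k); last by exists o.
    by rewrite (leq_trans (moment_step al be ab kI)) // -ew -ltnS.
  move: w0; rewrite ew /wk !mem_cat !inE !negb_or => /and4P[-> _ _ ->].
  by rewrite andbT adem_pair_neq0.
by case/choice => r rP; rewrite ew; eexists; apply: (reduces_step (r := r)) => //.
Qed.

Lemma reduces_terms_adm w o : reduces u w o -> all admissible (terms o).
Proof.
elim=> {w o} [w w_adm|al a b be r wk ab al_adm _ IH] /=; first by rewrite w_adm.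
by apply/allP => v /flatten_mapP[k kI]; apply: (allP (IH k kI)).
Qed.

Lemma reduces_terms_deg w o : reduces u w o -> all (fun v => wdeg v == wdeg w) (terms o).
Proof.
elim=> {w o} [w w_adm|al a b be r wk ab al_adm _ IH] /=; first by rewrite eqxx.
apply/allP => v /flatten_mapP[k kI vk]; rewrite (eqP (allP (IH k kI) v vk)).
by rewrite /wdeg !sumn_cat sumn_adem_pair //= ?addnA; case/andP: ab.
Qed.

Lemma wordA_cat v w : wordA (v ++ w) = wordA v * wordA w.
Proof. by rewrite /wordA big_cat. Qed.

Lemma Sq0 : Sq 0 = 1.
Proof.
have : toA (free_word [:: 0%N]) = toA 1 by apply/toAP; apply: ai_sq0.
by [].
Qed.

Lemma wordA2 a b : wordA [:: a; b] = Sq a * Sq b.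
Proof. by rewrite /wordA !big_cons big_nil mulr1. Qed.

Lemma wordA_adem_pair a b k : wordA (adem_pair a b k) = Sq (a + b - k) * Sq k.
Proof.
rewrite /wordA /adem_pair; case: eqP => [->|_]; rewrite !big_cons big_nil mulr1 //.
by rewrite Sq0 mulr1 subn0.
Qed.

Lemma steenrod_addKK (a b : steenrod) : a + b + b = a.
Proof. by rewrite -addrA -mulr2n steenrod_mul2 addr0. Qed.

Lemma adem_relation a b : (0 < a < b.*2)%N ->
  Sq a * Sq b = \sum_(k <- adem_idx a b) Sq (a + b - k) * Sq k.
Proof.
move=> ab; set X := free_word [:: a; b].
pose Y := \sum_(k <- adem_idx a b) free_word [:: (a + b - k)%N; k].
have YE : toA Y = \sum_(k <- adem_idx a b) Sq (a + b - k) * Sq k.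
  rewrite (raddf_sum toA); apply: eq_bigr => k _.
  exact: (etrans (esym (wordA_toA _)) (wordA2 _ _)).
have XE : toA X = Sq a * Sq b := etrans (esym (wordA_toA _)) (wordA2 _ _).
have /toAP : adem_ideal (X + Y - 0) by rewrite subr0; apply: ai_adem.
rewrite raddf0 (raddfD toA) /= XE YE => XY.
by rewrite -[LHS](steenrod_addKK _ (\sum_(k <- adem_idx a b) Sq (a + b - k) * Sq k)) XY add0r.
Qed.

Lemma wordA_step al a b be : (0 < a < b.*2)%N ->
  wordA (al ++ [:: a, b & be]) = \sum_(k <- adem_idx a b) wordA (al ++ adem_pair a b k ++ be).
Proof.
move=> ab; rewrite -[a :: _]/([:: a; b] ++ be) !wordA_cat wordA2.
rewrite adem_relation // mulr_suml mulr_sumr; apply: eq_bigr => k _.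
by rewrite !wordA_cat wordA_adem_pair.
Qed.

Lemma reduces_sumA w o : reduces u w o -> wordA w = sumA (terms o).
Proof.
elim=> {w o} [w w_adm|al a b be r wk ab al_adm _ IH] /=; first by rewrite /sumA big_seq1.
rewrite wordA_step // /sumA big_flatten big_map big_seq [RHS]big_seq.
by apply: eq_bigr => k kI; apply: IH.
Qed.

Hypothesis bd_u : forall a b, (0 < a < b.*2)%N -> bd (u a b) = ademD a b.

Let dbl (x : fsum) : D0 := \sum_(w <- x) wordD w *+ 2.

(** For admissible w the track is 0 while the right side is w + w, which the conditional term
    balances; in [bd_That] that term is supplied by the admissible words that [reduces_sum] records
    as cancelled. *)
Lemma reduces_bd w o : reduces u w o ->
  bd (track o) + dbl (cancelled o) + (if admissible w then wordD w *+ 2 else 0)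
  = wordD w + sumD (terms o).
Proof.
elim=> {w o} [w w_adm|al a b be r wk ab al_adm rr IH] /=.
  by rewrite w_adm (raddf0 bd) /dbl /sumD big_nil big_seq1 !add0r mulr2n.
rewrite (negbTE (inadmissible_step _ _ ab)) addr0 (raddfD bd) (raddf_sum bd) /=.
rewrite bd_word_act bd_act_word bd_u // /dbl /sumD !big_flatten !big_map /=.
rewrite -addrA -big_split /= /ademD mulrDl mulrDr mulr_suml mulr_sumr -addrA.
rewrite -[a :: _]/([:: a; b] ++ be) !wordD_cat.
have -> : wordD [:: a; b] = SqD a * SqD b by rewrite /wordD !big_cons big_nil mulr1.
congr (_ + _); rewrite -big_split /= big_seq [RHS]big_seq; apply: eq_bigr => k kI.
rewrite big_cat /= -!wordD_cat.
have := IH k kI; rewrite -/(dbl _) -/(sumD _) -/(wk k).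
case: ifP => [w_adm _|_].
  by rewrite (reduces_admE (rr k kI) w_adm) /= (raddf0 bd) /dbl /sumD !big_nil big_seq1 !addr0.
rewrite addr0 [dbl [:: _]]/dbl big_seq1 -/(dbl _) => e.
exact: (cancel_pair (D0_mul4 _) e).
Qed.

Lemma bd_That x o : reduces_sum u x o -> bd (That o) = sumD x + sumD (terms o).
Proof.
case=> r xr; set l := flatten _ => ->; rewrite /That /=.
have cE s : bd (\sum_(w <- s) mu0 (wordA w)) = dbl s.
  rewrite (raddf_sum bd); apply: eq_bigr => w _.
  exact: (etrans (bd_mu0 _) (some_lift_word w)).
rewrite (raddfD bd) (raddf_sum bd) /= cE /dbl !big_cat /= big_flatten big_map big_filter.
rewrite [LHS]addrA [LHS]addrA.
have -> : \sum_(w <- x) bd (track (r w)) + \sum_(w <- x | admissible w) wordD w *+ 2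
    + \sum_(w <- x) \sum_(v <- cancelled (r w)) wordD v *+ 2 = sumD x + sumD l.
  rewrite [X in _ + X + _]big_mkcond /sumD big_flatten big_map -!big_split /=.
  rewrite big_seq [RHS]big_seq.
  by apply: eq_bigr => w wx; rewrite addrAC; apply: reduces_bd; apply: xr.
have -> : sumD l = sumD (mod2 l) + \sum_(w <- mod2_pairs l) wordD w *+ 2.
  rewrite /sumD -big_undup_iterop_count big_filter big_flatten big_map /=.
  rewrite [X in _ = X + _]big_mkcond -big_split /=; apply: eq_bigr => w _.
  rewrite Monoid.iteropE /= big_nseq /=.
  have iterE (f : D0) n : iter n (+%R f) 0 = f *+ n.
    by elim: n => //= n ->; rewrite mulrS.
  rewrite !iterE -[in LHS](odd_double_half (count_mem w l)) mulrnDr -mul2n mulrnA.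
  by congr (_ + _); case: odd.
have p2 : (\sum_(w <- mod2_pairs l) wordD w *+ 2) *+ 2 = 0.
  by rewrite -sumrMnl big1 // => w _; rewrite -mulrnA D0_mul4.
by rewrite -[LHS]addrA -[X in _ + X]addrA -mulr2n p2 addr0.
Qed.

End Reduction.

(** * Spanning *)

Lemma sumA_cat x y : sumA (x ++ y) = sumA x + sumA y.
Proof. by rewrite /sumA big_cat. Qed.

Lemma sumA_flatten (I : Type) (s : seq I) (f : I -> fsum) :
  sumA (flatten [seq f i | i <- s]) = \sum_(i <- s) sumA (f i).
Proof. by rewrite /sumA big_flatten big_map. Qed.

Lemma wordA_span w :
  exists y, [/\ all admissible y, all (fun v => wdeg v == wdeg w) y & wordA w = sumA y].
Proof.
pose w' := [seq a <- w | a != 0%N].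
have w'0 : 0%N \notin w' by rewrite mem_filter.
have -> : wordA w = wordA w'.
  rewrite /wordA big_filter [RHS]big_mkcond /=; apply: eq_bigr => a _.
  by case: eqP => // ->; rewrite Sq0.
have -> : wdeg w = wdeg w'.
  rewrite /wdeg /w'; elim: w {w' w'0} => //= a w ->; case: eqP => [->|] //.
(* Only the terms are wanted, so the reduction is run with zero tracks. *)
have [o wo] := reduces_ex (fun _ _ => 0) w'0.
exists (terms o); split; [exact: reduces_terms_adm wo|exact: reduces_terms_deg wo|].
exact: reduces_sumA wo.
Qed.

Lemma steenrod_span a : exists2 y, all admissible y & a = sumA y.
Proof.
rewrite -(ofAK a); elim/freeA_ind: (ofA a) => [|x x' [y ya xy] [y' ya' xy']|w].
- by exists [::]; rewrite ?(raddf0 toA) // /sumA big_nil.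
- exists (y ++ y'); first by rewrite all_cat ya.
  by rewrite (raddfD toA) sumA_cat -xy -xy'.
by have [y [ya _ wy]] := wordA_span w; exists y => //; rewrite -wordA_toA.
Qed.

Lemma in_ASq1D a b : in_ASq1 a -> in_ASq1 b -> in_ASq1 (a + b).
Proof. by move=> [x ->] [y ->]; exists (x + y); rewrite mulrDl. Qed.

Lemma wordA_rcons w a : wordA (rcons w a) = wordA w * Sq a.
Proof. by rewrite -cats1 wordA_cat [wordA [:: _]]/wordA big_seq1. Qed.

(** * Words ending in Sq^1 *)

Lemma Sq1_Sq1 : Sq 1 * Sq 1 = 0.
Proof. by rewrite adem_relation // /adem_idx /= big_nil. Qed.

Lemma sumA_last1 (x : fsum) : all (fun w => last 0%N w == 1%N) x ->
  sumA x = sumA [seq take (size w).-1 w | w <- x] * Sq 1.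
Proof.
rewrite /sumA big_map mulr_suml => x1; rewrite big_seq [RHS]big_seq.
apply: eq_bigr => w /(allP x1); case/lastP: w => // w a.
rewrite last_rcons => /eqP->; rewrite size_rcons wordA_rcons.
by rewrite /= -cats1 take_size_cat.
Qed.

Lemma admissible_rcons1 w : admissible w -> last 0%N w != 1%N -> admissible (rcons w 1%N).
Proof.
case/lastP: w => // w a wa; rewrite last_rcons => a1.
rewrite admissible_rcons2 wa /=.
have : 0%N \notin rcons w a by case/andP: wa.
by rewrite mem_rcons inE negb_or => /andP[]; lia.
Qed.

(** Right multiplication by Sq^1 kills an admissible word ending in Sq^1 and turns any other into an
    admissible word ending in Sq^1. So A Sq^1 is spanned by admissible words ending in Sq^1, and
    independence forces the remaining words of x to cancel in pairs. *)
Lemma in_ASq1_even (x : fsum) : all admissible x ->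
  in_ASq1 (sumA x) <-> (forall w, last 0%N w != 1%N -> ~~ odd (count_mem w x)).
Proof.
move=> xa; split=> [[b xb] w w1|x_even].
  have [y ya eb] := steenrod_span b.
  pose y' := [seq rcons v 1%N | v <- y & last 0%N v != 1%N].
  have y'E : sumA y' = sumA x.
    rewrite xb eb /y' /sumA big_map big_filter mulr_suml big_mkcond /=.
    apply: eq_bigr => v _; case: ifP => v1.
      exact: wordA_rcons.
    have [v' ->] : exists v', v = rcons v' 1%N.
      case/lastP: v v1 => // v' a; rewrite last_rcons => /negbFE/eqP->.
      by exists v'.
    rewrite wordA_rcons -[RHS]mulrA Sq1_Sq1; exact: esym (mulr0 _).
  have xy'a : all admissible (x ++ y').
    rewrite all_cat xa; apply/allP => v' /mapP[v]; rewrite mem_filter => /andP[v1 vy] ->.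
    exact: admissible_rcons1 (allP ya v vy) v1.
  have xy'0 : sumA (x ++ y') = 0 by rewrite sumA_cat y'E -mulr2n steenrod_mul2.
  have := admissible_free xy'a xy'0 w; rewrite count_cat (_ : count_mem w y' = 0%N) ?addn0 //.
  by apply/count_memPn; apply: contraNN w1 => /mapP[v _ ->]; rewrite last_rcons.
exists (sumA [seq take (size w).-1 w | w <- mod2 x]).
rewrite -sumA_last1; first by rewrite /sumA -sum_mod2 // => w; apply: steenrod_mul2.
by apply/allP => w; rewrite mem_filter => /andP[wo _]; apply: contraLR wo; apply: x_even.
Qed.

(** * The linear system *)

Lemma mem_compositions s n w :
  (w \in compositions s n) = [&& 0%N \notin w, (size w <= s)%N & sumn w == n].
Proof.
elim: s n w => [|s IH] n [|a w] /=; rewrite mem_cat.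
- by rewrite orbF; case: n.
- by rewrite andbF orbF; case: n.
- rewrite (_ : ([::] \in [seq _ | _ <- _, _ <- _]) = false) ?orbF; first by case: n.
  by apply/negbTE/negP => /allpairsPdep[a [w [_ _]]].
have -> : (a :: w \in if n == 0%N then [:: [::]] else [::]) = false by case: eqP.
apply/allpairsPdep/and3P => /= [[a' [w' [a'n w'c [-> ->]]]]|[]].
  move: w'c; rewrite IH => /and3P[w'0 w's /eqP w'n]; move: a'n; rewrite mem_iota => a'n.
  by rewrite inE negb_or w'0 andbT ltnS w'n; split=> //; lia.
rewrite inE negb_or ltnS => /andP[a0 w0] ws /eqP awn.
exists a, w; rewrite mem_iota IH w0 ws; split=> //; lia.
Qed.

Lemma size_sumn w : 0%N \notin w -> (size w <= sumn w)%N.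
Proof.
elim: w => //= a w IH; rewrite inE negb_or => /andP[a0 /IH]; lia.
Qed.

Lemma mem_adm_words n w : (w \in adm_words n) = admissible w && (wdeg w == n).
Proof.
rewrite mem_filter mem_compositions; case w_adm: (admissible w) => //=.
have /andP[w0 _] := w_adm; rewrite w0 /= /wdeg; case: eqP => [<-|]; rewrite ?andbF //.
by rewrite size_sumn.
Qed.

Lemma mem_basisASq1 m w :
  (w \in basisASq1 m) = [&& last 0%N w != 1%N, admissible w & wdeg w == m].
Proof. by rewrite mem_filter mem_adm_words. Qed.

Lemma mem_cols m al j :
  ((al, j) \in cols m) = [&& (0 < j)%N, (2 ^ j < m)%N, admissible al & wdeg al == (m - 2 ^ j)%N].
Proof.
apply/allpairsPdep/and4P => [[j' [al' [j'm al'm [-> ->]]]]|[j0 jm al_adm al_deg]].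
  by move: j'm al'm; rewrite mem_filter mem_iota mem_adm_words => /and3P[-> -> _] /andP[].
exists j, al; rewrite mem_filter mem_iota mem_adm_words jm j0 al_adm al_deg; split=> //=.
by have := ltn_expl j (ltnSn 1); lia.
Qed.

Lemma F2_muln (G : zmodType) (g : G) (c d : 'F_2) : g *+ 2 = 0 ->
  g *+ (c + d)%R = g *+ c + g *+ d.
Proof.
move=> g2; case: c d => [[|[|c]] // ic] [[|[|d]] // id];
  by rewrite /= ?mulr0n ?mulr1n ?add0r ?addr0 // -mulr2n g2.
Qed.

Lemma big_chosen (G : zmodType) (F : word * nat -> G) m (c : coefs m) :
  \sum_(p <- chosen c) F p = \sum_i F (tnth (in_tuple (cols m)) i) *+ c 0 i.
Proof.
rewrite /chosen big_map big_filter big_mkcond big_enum /=; apply: eq_bigr => i _.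
by case: (c 0 i) => [[|[|k]] // ik]; rewrite ?mulr0n ?mulr1n.
Qed.

Lemma chosen_list m (s : seq (word * nat)) : {subset s <= cols m} ->
  exists c : coefs m,
    \sum_(p <- chosen c) wordA (col_word p) = \sum_(p <- s) wordA (col_word p).
Proof.
elim: s => [|p s IH] sm.
  exists 0; rewrite big_chosen big_nil big1 // => i _.
  by rewrite mxE mulr0n.
have [q qs|c cE] := IH; first by apply: sm; rewrite inE qs orbT.
have pm : (index p (cols m) < size (cols m))%N by rewrite index_mem sm // mem_head.
(* Over F_2, adding a unit vector toggles one column, so a pair repeated in s cancels on both
   sides. *)
exists (c + delta_mx 0 (Ordinal pm)); rewrite big_cons -cE !big_chosen.
under eq_bigr => i _ do rewrite mxE F2_muln ?steenrod_mul2 // mxE eqxx /=.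
rewrite big_split addrC /=; congr (_ + _).
rewrite (bigD1 (Ordinal pm)) //= eqxx mulr1n big1 ?addr0.
  by rewrite (tnth_nth p) /= nth_index ?sm ?mem_head.
by move=> i /negbTE->; rewrite mulr0n.
Qed.

Lemma coords_eq0 m (x : fsum) : all admissible x -> all (fun w => wdeg w == m) x ->
  (coords m x = 0) <-> in_ASq1 (sumA x).
Proof.
move=> xa xm; have F2E n : (n%:R == 0 :> 'F_2) = ~~ odd n.
  by rewrite -(dvdn_pcharf (pchar_Fp (isT : prime 2))) dvdn2.
split=> [x0|/(in_ASq1_even xa) x_even].
  apply/in_ASq1_even => // w w1; have [wx|/count_memPn-> //] := boolP (w \in x).
  have wB : w \in basisASq1 m by rewrite mem_basisASq1 w1 (allP xa) // (allP xm).
  have iB : (index w (basisASq1 m) < size (basisASq1 m))%N by rewrite index_mem.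
  have /eqP := congr1 (fun v : 'rV_ _ => v 0 (Ordinal iB)) x0.
  by rewrite !mxE /= nth_index // F2E.
apply/rowP => i; rewrite !mxE; apply/eqP; rewrite F2E; apply: x_even.
by have := mem_nth [::] (ltn_ord i); rewrite mem_basisASq1 => /andP[].
Qed.

Lemma coords_cat m x y : coords m (x ++ y) = coords m x + coords m y.
Proof. by apply/rowP => i; rewrite !mxE count_cat natrD. Qed.

(** * Decomposability of Sq^m *)

(** Since (a+1) C(2^j, a+1) = 2^j C(2^j - 1, a), an odd C(2^j, a+1) would make 2^j divide a+1 < 2^j.
    So these binomials are even, and by Pascal's rule the parity is constant along the row 2^j - 1,
    which starts with 1. *)
Lemma odd_bin_pow2 j a : (a < 2 ^ j)%N -> odd 'C((2 ^ j).-1, a).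
Proof.
elim: a => [|a IH] aj; first by rewrite bin0.
have pj : (2 ^ j = (2 ^ j).-1.+1)%N by rewrite prednK // expn_gt0.
suff : ~~ odd 'C(2 ^ j, a.+1) by rewrite [in 'C(_, _)]pj binS oddD IH 1?ltnW //; case: odd.
apply/negP => C_odd; have := mul_bin_diag (2 ^ j) a => e.
have : (2 ^ j %| a.+1)%N.
  rewrite -(@Gauss_dvdl _ _ 'C(2 ^ j, a.+1)); first by rewrite -e dvdn_mulr.
  by rewrite coprimeXl // coprime2n.
by move/dvdn_leq => /(_ isT); rewrite leqNgt aj.
Qed.

(** The part of degree n of the left ideal generated by the Sq^(2^j). Here j = 0 is included and the
    left factors are arbitrary words, unlike in [cols]. *)
Definition in_pow2_ideal (n : nat) (a : steenrod) : Prop :=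
  exists2 s : seq (word * nat), all (fun p => wdeg p.1 + 2 ^ p.2 == n)%N s &
    a = \sum_(p <- s) wordA (col_word p).

Lemma in_pow2_idealD n a b :
  in_pow2_ideal n a -> in_pow2_ideal n b -> in_pow2_ideal n (a + b).
Proof.
by case=> s sn -> [t tn ->]; exists (s ++ t); rewrite ?all_cat ?sn // big_cat.
Qed.

Lemma in_pow2_idealM i n a : in_pow2_ideal n a -> in_pow2_ideal (i + n) (Sq i * a).
Proof.
case=> s sn ->; exists [seq (i :: p.1, p.2) | p <- s].
  rewrite all_map; apply: sub_all sn => -[w j] /= /eqP <-.
  by rewrite /wdeg /= addnA.
rewrite big_map mulr_sumr; apply: eq_bigr => p _.
by rewrite /col_word /= /wordA big_cons.
Qed.

(* For n = a + 2^j with 0 < a < 2^j, the coefficient C(2^j - 1, a) of Sq^n in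
   [a, 2^j] is odd. *)
Lemma Sq_in_pow2_ideal n : (0 < n)%N -> in_pow2_ideal n (Sq n).
Proof.
have [N] := ubnP n; elim: N n => // N IH n nN n0.
pose j := trunc_log 2 n.
have jn : (2 ^ j <= n)%N by apply: trunc_logP.
have nj : (n < 2 ^ j.+1)%N by apply: trunc_log_ltn.
have [en|nne] := eqVneq n (2 ^ j)%N.
  exists [:: ([::], j)]; first by rewrite /= /wdeg -en add0n eqxx.
  by rewrite big_seq1 /wordA big_seq1 /= -en.
pose a := (n - 2 ^ j)%N.
have a0 : (0 < a)%N by rewrite subn_gt0 ltn_neqAle eq_sym nne.
have aj : (a < 2 ^ j)%N by move: nj; rewrite /a expnS; lia.
have aj2 : (0 < a < (2 ^ j).*2)%N by lia.
have anE : (a + 2 ^ j = n)%N by rewrite subnK.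
have rel := adem_relation aj2; rewrite anE in rel.
have idx0 : 0%N \in adem_idx a (2 ^ j).
  by rewrite mem_filter mem_iota double0 !subn0 subn1 odd_bin_pow2.
have -> : Sq n = Sq a * Sq (2 ^ j) + \sum_(k <- rem 0%N (adem_idx a (2 ^ j))) Sq (n - k) * Sq k.
  by rewrite rel (big_rem _ idx0) /= subn0 Sq0 mulr1 -addrA -mulr2n steenrod_mul2 addr0.
apply: in_pow2_idealD.
  exists [:: ([:: a], j)]; first by rewrite /= /wdeg /= addn0 anE eqxx.
  by rewrite big_seq1 [RHS]wordA2.
rewrite big_seq; elim/big_ind: _ => [||k].
- by exists [::]; rewrite ?big_nil.
- by move=> x y; apply: in_pow2_idealD.
rewrite mem_rem_uniq ?filter_uniq ?iota_uniq // inE /= mem_filter mem_iota => /and3P[k0 _ ka].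
have kn : (k < n)%N by have := half_leq (ltnW aj); lia.
rewrite -{1}(subnK (ltnW kn)); apply: in_pow2_idealM; apply: IH; last by rewrite lt0n.
by rewrite (leq_trans kn).
Qed.

Lemma solution_exists m : (0 < m)%N -> ~ (exists k, m = (2 ^ k)%N) ->
  exists c : coefs m, solution c.
Proof.
move=> m0 m_npow; have [s sm Sqm] := Sq_in_pow2_ideal m0.
have sP p : p \in s -> (2 ^ p.2 < m)%N /\ wdeg p.1 = (m - 2 ^ p.2)%N.
  move=> /(allP sm)/eqP e; split; last by rewrite -e addnK.
  rewrite ltn_neqAle -{2}e leq_addl andbT; apply/eqP => e2; apply: m_npow.
  by exists p.2.
suff : exists2 t : seq (word * nat), {subset t <= cols m} &
    in_ASq1 (Sq m + \sum_(p <- t) wordA (col_word p)).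
  by case=> t tm; have [c <-] := chosen_list tm; exists c.
rewrite Sqm; elim: s {sm Sqm} sP => [|[w j] s IH] sP.
  by exists [::] => //; exists 0; rewrite !big_nil addr0 mul0r.
have [|t tm sum_in] := IH; first by move=> p ps; apply: sP; rewrite inE ps orbT.
have [/= jm wd] := sP _ (mem_head _ _).
(* A term with j = 0 already lies in A Sq^1 and gives no column; for j > 0 the left factor is
   expanded in admissible words. *)
case: j jm wd {sP} => [|j] jm wd.
  exists t => //; rewrite big_cons -addrA; apply: in_ASq1D => //.
  by exists (wordA w); apply: wordA_rcons.
have [y [ya yd wy]] := wordA_span w.
exists ([seq (v, j.+1) | v <- y] ++ t).
  move=> p; rewrite mem_cat => /orP[/mapP[v vy ->]|/tm //].
  by rewrite mem_cols jm (allP ya) // (eqP (allP yd v vy)) wd eqxx.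
rewrite big_cons big_cat big_map /=.
have -> : \sum_(v <- y) wordA (col_word (v, j.+1)) = wordA (col_word (w, j.+1)).
  rewrite /col_word /= wordA_rcons wy /sumA mulr_suml.
  by apply: eq_bigr => v _; rewrite wordA_rcons.
rewrite addrACA -mulr2n steenrod_mul2 add0r.
exact: sum_in.
Qed.

Lemma rmorph1_eq2 (S T : nzRingType) (f : {rmorphism S -> T}) x :
  f x = 1 -> eq2 x 0 -> 2%:R = 0 :> T.
Proof. by move=> fx; rewrite -fx -rmorphMn /eq2 mul0rn => ->; apply: rmorph0. Qed.

(** Setting all variables to 1 sends the power to 1 in Z/4, where 2 is not 0. *)
Lemma eq2_xvar_pow_neq0 i n : ~ eq2 (xvar i ^+ n) 0.
Proof.
pose f := Veval (S := 'Z_4) idfun (fun=> 1).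
have fX : f (xvar i ^+ n) = 1.
  apply: (etrans (rmorphXn f n (xvar i))).
  exact: (etrans (congr1 (fun z => z ^+ n) (Veval_xvar _ _ i)) (expr1n _ n)).
by move=> /(rmorph1_eq2 fX)/eqP.
Qed.

Lemma sq_pow2 n i k : eq2 (sq n 0 (xvar i ^+ (2 ^ k)))
  (xvar i ^+ (2 ^ k) *+ (n == 0) + xvar i ^+ (2 ^ k.+1) *+ (n == 2 ^ k)%N).
Proof.
have := sq_xvar_pow n 0 i k 1; rewrite !sq1 add0n !mulr_natr !mulr1.
exact.
Qed.

(* On x_0^m, m = 2^k, every Sq^i with 0 < i < m vanishes, but Sq^m x_0^m = x_0^(2m). *)
Lemma no_solution_pow2 k : (0 < k)%N -> forall c : coefs (2 ^ k), ~ solution c.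
Proof.
move=> k0 c [b sol]; set m := (2 ^ k)%N in c sol *.
(* Because k > 0, Sq^1 is among the squares below m that kill x_0^m modulo 2, so b Sq^1 vanishes
   there too. *)
have m1 : (1 < m)%N by rewrite /m -{1}(expn0 2) ltn_exp2l.
pose X := xvar 0 ^+ m.
have kill n : (0 < n < m)%N -> eq2 (D0_ev X (SqD n)) 0.
  move=> nm; rewrite D0_ev_SqD; apply: etrans (sq_pow2 n 0 k) _.
  have [n0 n1] : n != 0%N /\ n != m by lia.
  by rewrite (negbTE n0) (negbTE n1) !mulr0n addr0.
have killM n w : (0 < n < m)%N -> eq2 (D0_ev X (wordD (rcons w n))) 0.
  move=> /kill kX; rewrite -cats1 wordD_cat [wordD [:: _]]/wordD big_seq1 D0_evM.
  by apply: (etrans (eq2_raddf (wordD w) kX)); rewrite raddf0.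
have sumE : eq2 (sumD (ysum c)) (some_lift b * SqD 1).
  have e : sumA (ysum c) = b * Sq 1.
    by rewrite -sol /sumA /ysum big_cons big_map [wordA [:: m]]/wordA big_seq1.
  apply: (etrans (esym (some_lift_sum _))); rewrite e.
  exact: (etrans (some_liftM b (Sq 1)) (eq2Ml (some_lift b) (some_lift_Sq 1))).
have cP p : p \in chosen c -> (0 < 2 ^ p.2 < m)%N.
  case: p => al j /mapP[i _ ij]; have := mem_tnth i (in_tuple (cols m)).
  by rewrite -ij => ijm; move: (ijm : _ \in cols m); rewrite mem_cols expn_gt0 => /and4P[].
have XL : eq2 (D0_ev X (sumD (ysum c))) (xvar 0 ^+ (2 ^ k.+1)).
  rewrite /ysum /sumD big_cons raddfD big_map raddf_sum.
  rewrite [wordD [:: _]]/wordD big_seq1 -[X in eq2 _ X]addr0; apply: eq2D.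
    rewrite /= D0_ev_SqD; apply: (etrans (sq_pow2 m 0 k)).
    have m_neq0 : m != 0%N by lia.
    by rewrite (negbTE m_neq0) eqxx mulr0n mulr1n add0r.
  elim: (chosen c) cP => [|p s IH] sP; first by rewrite big_nil.
  rewrite big_cons -[X in eq2 _ X]addr0; apply: eq2D.
    by apply: killM; apply: sP; rewrite mem_head.
  by apply: IH => q qs; apply: sP; rewrite inE qs orbT.
have XR : eq2 (D0_ev X (some_lift b * SqD 1)) 0.
  rewrite D0_evM; apply: (etrans (eq2_raddf (some_lift b) (kill 1%N m1))).
  by rewrite raddf0.
apply: (@eq2_xvar_pow_neq0 0 (2 ^ k.+1)).
exact: (etrans (esym XL) (etrans (eq2_raddf (D0_ev X) sumE) XR)).
Qed.

(** By independence two normal forms of one element differ only in the order of their words, so the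
    choice made in [normal_form] does not affect the lift. *)
Lemma normal_form_sum (X : fsum) : uniq X -> all admissible X ->
  adm_lift (sumA X) = sumD X.
Proof.
move=> uX aX; have XN : is_normal_form (sumA X) X by [].
have [uN aN eN] : is_normal_form (sumA X) (normal_form (sumA X)).
  exact: (classical_sets.xgetPex [::] (ex_intro _ X XN)).
rewrite /adm_lift; set N := normal_form (sumA X) in uN aN eN *.
apply: perm_big; apply: uniq_perm => // w.
have NX0 : sumA (N ++ X) = 0 by rewrite sumA_cat eN -mulr2n steenrod_mul2.
have NXa : all admissible (N ++ X) by rewrite all_cat aN.
have := admissible_free NXa NX0 w; rewrite count_cat !count_uniq_mem // oddD !oddb.
by case: (w \in N); case: (w \in X).
Qed.

(** * Correctness of the procedure and of the track *)

Section System.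

Variables (u : nat -> nat -> D1) (m : nat).
Hypothesis m_gt0 : (0 < m)%N.

Let colr (i : 'I_(size (cols m))) := col_word (tnth (in_tuple (cols m)) i).

Lemma colr_neq0 i : 0%N \notin colr i.
Proof.
rewrite /colr; have : tnth (in_tuple (cols m)) i \in cols m := mem_tnth i (in_tuple (cols m)).
case: (tnth _ _) => al j; rewrite mem_cols => /and4P[_ _ /andP[al0 _] _].
by rewrite mem_rcons inE negb_or al0 andbT eq_sym -lt0n expn_gt0.
Qed.

Lemma colr_deg i : wdeg (colr i) = m.
Proof.
rewrite /colr; have : tnth (in_tuple (cols m)) i \in cols m := mem_tnth i (in_tuple (cols m)).
case: (tnth _ _) => al j; rewrite mem_cols => /and4P[_ jm _ /eqP al_deg].
by rewrite /wdeg /col_word sumn_rcons -/(wdeg _) al_deg subnK // ltnW.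
Qed.

Section Run.

Variables (r0 : outcome) (r : 'I_(size (cols m)) -> outcome).
Hypothesis r0P : reduces u [:: m] r0.
Hypothesis rP : forall i, reduces u (colr i) (r i).

Let v := coords m (terms r0).
Let M := \matrix_i coords m (terms (r i)).

Let combined (c : coefs m) : fsum :=
  terms r0 ++ flatten [seq terms (r i) | i <- enum 'I_(size (cols m)) & c 0 i != 0].

Lemma coords_combined c : coords m (combined c) = v + c *m M.
Proof.
rewrite coords_cat; congr (_ + _); rewrite mulmx_sum_row.
have coords_flatten (s : seq 'I_(size (cols m))) :
    coords m (flatten [seq terms (r i) | i <- s]) = \sum_(i <- s) coords m (terms (r i)).
  elim: s => [|i s IH]; last by rewrite big_cons /= coords_cat IH.
  by rewrite big_nil; apply/rowP => j; rewrite !mxE.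
rewrite coords_flatten big_filter big_mkcond big_enum /=; apply: eq_bigr => i _.
rewrite rowK; case: (c 0 i) => [[|[|k]] // ik].
  by rewrite (_ : Ordinal ik = 0) ?scale0r //; apply: val_inj.
by rewrite (_ : Ordinal ik = 1) ?scale1r //; apply: val_inj.
Qed.

(** The reduced terms of Sq^m and of the selected columns have coordinates v + c M, which vanish
    exactly when the sum lies in A Sq^1; over F_2 this means v = c M. *)
Lemma solutionE c : solution c <-> v = c *m M.
Proof.
have combA : all admissible (combined c).
  rewrite all_cat (reduces_terms_adm r0P); apply/allP => w /flatten_mapP[i _].
  exact: (allP (reduces_terms_adm (rP i))).
have combD : all (fun w => wdeg w == m) (combined c).
  rewrite all_cat; apply/andP; split.
    by have := reduces_terms_deg r0P; rewrite /wdeg /= addn0.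
  apply/allP => w /flatten_mapP[i _].
  by have := allP (reduces_terms_deg (rP i)) w; rewrite colr_deg.
have combS : sumA (combined c) = Sq m + \sum_(p <- chosen c) wordA (col_word p).
  rewrite sumA_cat -(reduces_sumA r0P) [wordA [:: m]]/wordA big_seq1; congr (_ + _).
  rewrite sumA_flatten /chosen big_map.
  by apply: eq_bigr => i _; rewrite -(reduces_sumA (rP i)).
have := coords_eq0 combA combD; rewrite combS coords_combined => e.
have F2N (x : 'rV['F_2]_(size (basisASq1 m))) : - x = x.
  by apply/rowP => i; rewrite mxE; case: (x 0 i) => [[|[|k]] // ik]; apply: val_inj.
split=> [/e/eqP|vM]; first by rewrite addr_eq0 F2N => /eqP.
by apply/e; rewrite vM -{2}[_ *m _]F2N subrr.
Qed.

End Run.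

Lemma procedure_ex_uniq : exists! out : option (coefs m), procedure u out.
Proof.
have [r0 r0P] : exists o, reduces u [:: m] o by apply: reduces_ex; rewrite inE eq_sym -lt0n.
have [r rP] := choice (fun i => reduces_ex u (colr_neq0 i)).
eexists; split; first by exists r0, r; split.
move=> out [r0' [r' [r0'P r'P ->]]].
rewrite (reduces_fun r0P r0'P) (_ : r = r') //.
by apply/funext => i; apply: reduces_fun (rP i) (r'P i).
Qed.

Lemma procedure_correct (out : option (coefs m)) : procedure u out ->
  if out is Some c then solution c else forall c : coefs m, ~ solution c.
Proof.
case=> r0 [r [r0P rP ->]] /=.
case: ifPn => vM; first by apply/(solutionE r0P rP); rewrite mulmxKpV.
by move=> c /(solutionE r0P rP) vE; case/negP: vM; rewrite vE submxMl.
Qed.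

End System.

Lemma solution_track (u : nat -> nat -> D1)
    (bd_u : forall a b, (0 < a < b.*2)%N -> bd (u a b) = ademD a b)
    (m : nat) (m_gt0 : (0 < m)%N) (c : coefs m) (o : outcome) :
  solution c -> reduces_sum u (ysum c) o ->
  (exists2 b, homogA m.-1 b & sumA (terms o) = b * Sq 1) /\
  (forall b, homogA m.-1 b -> sumA (terms o) = b * Sq 1 -> bd (That o) = d1 (rtilde c b)).
Proof.
move=> sol co; case: (co) => r rP oE.
pose l := flatten [seq terms (r w) | w <- ysum c].
have oT : terms o = mod2 l by rewrite oE.
have yD w : w \in ysum c -> wdeg w = m.
  rewrite inE => /orP[/eqP->|/mapP[p /mapP[i _ ->] ->]]; first by rewrite /wdeg /= addn0.
  exact: colr_deg.
have oU : uniq (terms o) by rewrite oT filter_uniq ?undup_uniq.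
have lP w : w \in terms o -> admissible w /\ wdeg w = m.
  rewrite oT mem_filter mem_undup => /andP[_ /flatten_mapP[w' w'y wt]].
  rewrite (allP (reduces_terms_adm (rP w' w'y)) w wt).
  by rewrite (eqP (allP (reduces_terms_deg (rP w' w'y)) w wt)) yD.
have oA : all admissible (terms o) by apply/allP => w /lP[].
have oS : sumA (terms o) = sumA (ysum c).
  rewrite oT /sumA -sum_mod2; last by move=> w; apply: steenrod_mul2.
  rewrite -/(sumA l) sumA_flatten big_seq [RHS]big_seq.
  by apply: eq_bigr => w wy; rewrite -(reduces_sumA (rP w wy)).
have oI : in_ASq1 (sumA (terms o)).
  by rewrite oS /sumA /ysum big_cons big_map [wordA [:: m]]/wordA big_seq1.
split.
  have o1 : all (fun w => last 0%N w == 1%N) (terms o).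
    apply/allP => w wo; have := (in_ASq1_even oA).1 oI w.
    by rewrite count_uniq_mem // wo; case: eqP => // _ /(_ isT).
  exists (sumA [seq take (size w).-1 w | w <- terms o]); last exact: sumA_last1.
  exists [seq take (size w).-1 w | w <- terms o] => //.
  apply/allP => _ /mapP[w wo ->]; have [_] := lP w wo; move: (allP o1 w wo).
  case/lastP: w {wo} => // w a; rewrite last_rcons => /eqP-> <-.
  by rewrite size_rcons /= -cats1 take_size_cat // /wdeg sumn_cat /= addn1.
move=> b _ ob; rewrite (bd_That bd_u co) /d1 /= -ob normal_form_sum //; congr (_ + _).
rewrite /sumD /ysum /rsum !big_cons !big_map /= [wordD [::]]/wordD big_nil mul1r.
rewrite [wordD [:: m]]/wordD big_seq1; congr (_ + _); apply: eq_bigr => p _.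
by rewrite /col_word -cats1 wordD_cat [wordD [:: _]]/wordD big_seq1.
Qed.

Theorem theorem3p3 (u : nat -> nat -> D1)
    (bd_u : forall a b, (0 < a < b.*2)%N -> bd (u a b) = ademD a b)
    (m : nat) (m_gt0 : (0 < m)%N) (m_even : ~~ odd m) :
  [/\ [/\ forall w : word, 0%N \notin w -> exists! o, reduces u w o,
         exists! out : option (coefs m), procedure u out &
         forall out : option (coefs m), procedure u out ->
           if out is Some c then solution c
           else forall c : coefs m, ~ solution c],
      (exists k, m = (2 ^ k)%N) -> forall c : coefs m, ~ solution c,
      ~ (exists k, m = (2 ^ k)%N) -> exists c : coefs m, solution c &
      forall c : coefs m, solution c ->
      forall o, reduces_sum u (ysum c) o ->
        (exists2 b, homogA m.-1 b & sumA (terms o) = b * Sq 1) /\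
        (forall b, homogA m.-1 b -> sumA (terms o) = b * Sq 1 ->
           bd (That o) = d1 (rtilde c b))].
Proof.
split; [split| | |].
- move=> w /(reduces_ex u)[o wo]; exists o; split=> // o'; exact: reduces_fun.
- exact: procedure_ex_uniq.
- exact: procedure_correct.
(* Evenness of m rules out k = 0. *)
- by case=> k mk; subst m; apply: no_solution_pow2; case: k m_gt0 m_even.
- exact: solution_exists.
- by move=> c sol o; apply: solution_track.
Qed.
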